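(* Let $(\Lambda,d)$ be a finitely aligned $k$-graph. Let $\{e_x:x\in\Lambda^{\le\infty}\}$ be the canonical orthonormal basis of $\ell^2(\Lambda^{\le\infty})$, and for $\lambda\in\Lambda$ define an operator $S_\lambda$ on $\ell^2(\Lambda^{\le\infty})$ by $$S_\lambda e_x:=\begin{cases}e_{\lambda x}&\text{if }s(\lambda)=r(x)\\0&\text{otherwise.}\end{cases}$$ Then $\{S_\lambda:\lambda\in\Lambda\}$ is a Cuntz-Krieger $\Lambda$-family. Furthermore, $S_v$ is nonzero for every $v\in\Lambda^0$.
   Context: Conventions: $0\in\mathbb{N}$; $\mathbb{N}^k$ is a semigroup with generators $e_1,\dots,e_k$, coordinatewise partial order $\le$, and $m\vee n$ denotes the coordinatewise maximum. A $k$-graph $(\Lambda,d)$ is a countable small category $\Lambda$ with a functor $d:\Lambda\to\mathbb{N}^k$ satisfying the factorisation property: if $d(\lambda)=m+n$ there are unique $\mu,\sigma\in\Lambda$ with $d(\mu)=m$, $d(\sigma)=n$, $\lambda=\mu\sigma$. Morphisms are called paths, objects vertices; $s$ and $r$ are the domain and codomain maps, so $\lambda\mu$ is defined when $s(\lambda)=r(\mu)$. $\Lambda^n:=\{\lambda:d(\lambda)=n\}$, and objects are identified with $\Lambda^0$. For $v\in\Lambda^0$, $v\Lambda:=\{\lambda\in\Lambda:r(\lambda)=v\}$ and $v\Lambda^{n}:=v\Lambda\cap\Lambda^n$. For $\lambda,\mu\in\Lambda$, $\Lambda^{\min}(\lambda,\mu):=\{(\alpha,\beta):\lambda\alpha=\mu\beta,\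 d(\lambda\alpha)=d(\lambda)\vee d(\mu)\}$. $\Lambda$ is finitely aligned if every $\Lambda^{\min}(\lambda,\mu)$ is finite (possibly empty). A set $E\subset v\Lambda$ is exhaustive if for every $\mu\in v\Lambda$ there is $\lambda\in E$ with $\Lambda^{\min}(\lambda,\mu)\ne\emptyset$. A Cuntz-Krieger $\Lambda$-family is a collection $\{t_\lambda:\lambda\in\Lambda\}$ of partial isometries in a $C^*$-algebra such that (i) $\{t_v:v\in\Lambda^0\}$ are mutually orthogonal projections; (ii) $t_\lambda t_\mu=t_{\lambda\mu}$ whenever $s(\lambda)=r(\mu)$; (iii) $t_\lambda^*t_\mu=\sum_{(\alpha,\beta)\in\Lambda^{\min}(\lambda,\mu)}t_\alpha t_\beta^*$ for all $\lambda,\mu\in\Lambda$; (iv) $\prod_{\lambda\in E}(t_v-t_\lambda t_\lambda^* )=0$ for all $v\in\Lambda^0$ and all finite exhaustive $E\subset v\Lambda$. Boundary paths: for $m\in(\mathbb{N}\cup\{\infty\})^k$, $\Omega_{k,m}$ is the $k$-graph with objects $\{p\in\mathbb{N}^k:p\le m\}$, morphisms $\{(p,q):p\le q\}$ ($p,q$ objects), $r(p,q)=p$, $s(p,q)=q$, $d(p,q)=q-p$. A graph morphism is a degree-preserving functor. A boundary path of $\Lambda$ is a graph morphism $x:\Omega_{k,m}\to\Lambda$, for some $m\in(\mathbb{N}\cup\{\infty\})^k$, for which there is $n_x\in\mathbb{N}^k$ with $n_x\le m$ such that: whenever $n\in\mathbb{N}^k$, $n_x\le n\le m$ and $n_i=m_i$,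 one has $x(n)\Lambda^{e_i}=\emptyset$. Put $r(x):=x(0)$ and $d(x):=m$. $\Lambda^{\le\infty}$ is the set of all boundary paths. If $s(\lambda)=r(x)$, $\lambda x:\Omega_{k,m+d(\lambda)}\to\Lambda$ is the unique graph morphism with $(\lambda x)(0,d(\lambda))=\lambda$ and $(\lambda x)(d(\lambda),n)=x(0,n-d(\lambda))$ for all $n\in\mathbb{N}^k$ with $d(\lambda)\le n\le m+d(\lambda)$; it is again a boundary path. *)

(* Defs.v *)
From HB Require Import structures.
From mathcomp Require Import all_boot all_order all_algebra.
From mathcomp Require Import boolp classical_sets functions cardinality.
From mathcomp Require Import fsbigop reals ereal numfun esum.
From mathcomp Require Import complex ring lra.

Set Implicit Arguments.
Unset Strict Implicit.
Unset Printing Implicit Defensive.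
Import Order.TTheory GRing.Theory Num.Theory.
Local Open Scope classical_set_scope.
Local Open Scope ring_scope.

(* In [ideg k], i.e. (N u {oo})^k, [None] stands for oo. *)

Notation deg k := {ffun 'I_k -> nat}.
Notation ideg k := {ffun 'I_k -> option nat}.

Section Degrees.
Variable k : nat.
Implicit Types (m n p q : deg k) (M : ideg k).

Definition dle m n : bool := [forall i, (m i <= n i)%N].
Definition dsub m n : deg k := [ffun i => (m i - n i)%N].
Definition djoin m n : deg k := [ffun i => maxn (m i) (n i)].
Definition dunit (i : 'I_k) : deg k := [ffun j => nat_of_bool (j == i)].

Definition dlei n M : bool :=
  [forall i, if M i is Some a then (n i <= a)%N else true].
Definition daddi n M : ideg k := [ffun i => omap (addn (n i)) (M i)].

Lemma dleP m n : reflect (forall i, (m i <= n i)%N) (dle m n).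
Proof. exact: forallP. Qed.

Lemma dle_refl m : dle m m.
Proof. by apply/dleP => i. Qed.

Lemma dle_trans n m p : dle m n -> dle n p -> dle m p.
Proof. by move=> /dleP mn /dleP np; apply/dleP => i; exact: leq_trans (np i). Qed.

Lemma dle0 m : dle 0 m.
Proof. by apply/dleP => i; rewrite ffunE. Qed.

Lemma dle_dlei n m M : dle n m -> dlei m M -> dlei n M.
Proof.
move=> /dleP nm /forallP mM; apply/forallP => i.
by move: (mM i); case: (M i) => // a; exact: leq_trans.
Qed.

Lemma dlei0 M : dlei 0 M.
Proof. by apply/forallP => i; rewrite ffunE; case: (M i). Qed.

Lemma dsub_id m : dsub m m = 0.
Proof. by apply/ffunP => i; rewrite !ffunE subnn. Qed.

Lemma daddK m n : dsub (m + n) m = n.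
Proof. by apply/ffunP => i; rewrite !ffunE addrC addnK. Qed.

Lemma dsubKC m n : dle m n -> m + dsub n m = n.
Proof. by move=> /dleP mn; apply/ffunP => i; rewrite !ffunE; exact: subnKC. Qed.

Lemma dle_addr m n : dle m (m + n).
Proof. by apply/dleP => i; rewrite ffunE; exact: leq_addr. Qed.

Lemma dle_add2l p m n : dle (p + m) (p + n) = dle m n.
Proof. by apply: eq_forallb => i; rewrite !ffunE; exact: leq_add2l. Qed.

End Degrees.

(* [kcomp l m], which stands for the product l m, is only meaningful when
   [src l = rng m]; every use of it below is guarded accordingly.  The vertex
   v is identified with the path [idp v] of degree 0. *)
Record kgraph (k : nat) := KGraph {
  kpath :> countType;
  vertex : countType;
  rng : kpath -> vertex;
  src : kpath -> vertex;
  idp : vertex -> kpath;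
  kcomp : kpath -> kpath -> kpath;
  kdeg : kpath -> deg k;
  rng_idp : forall v, rng (idp v) = v;
  src_idp : forall v, src (idp v) = v;
  rng_comp : forall l m, src l = rng m -> rng (kcomp l m) = rng l;
  src_comp : forall l m, src l = rng m -> src (kcomp l m) = src m;
  comp_idl : forall l, kcomp (idp (rng l)) l = l;
  comp_idr : forall l, kcomp l (idp (src l)) = l;
  comp_assoc : forall l m n, src l = rng m -> src m = rng n ->
    kcomp l (kcomp m n) = kcomp (kcomp l m) n;
  deg_idp : forall v, kdeg (idp v) = 0;
  deg_comp : forall l m, src l = rng m -> kdeg (kcomp l m) = kdeg l + kdeg m;
  factorisation : forall l m n, kdeg l = m + n ->
    exists! ms : kpath * kpath,
      [/\ kdeg ms.1 = m, kdeg ms.2 = n, src ms.1 = rng ms.2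
        & l = kcomp ms.1 ms.2]
}.

Section KGraph.
Variables (k : nat) (L : kgraph k).
Implicit Types (l m : L) (v : vertex L) (E : set L).

Definition min_ext l m : set (L * L) :=
  [set ab | [/\ src l = rng ab.1, src m = rng ab.2,
                kcomp l ab.1 = kcomp m ab.2
              & kdeg (kcomp l ab.1) = djoin (kdeg l) (kdeg m)]].

Definition finitely_aligned : Prop := forall l m, finite_set (min_ext l m).

Definition exhaustive v E : Prop :=
  E `<=` [set l | rng l = v] /\
  forall m, rng m = v -> exists2 l, E l & min_ext l m !=set0.

End KGraph.

Record gmorph (k : nat) (L M : kgraph k) := GMorph {
  gobj : vertex L -> vertex M;
  gpath :> L -> M;
  gmorph_rng : forall l, rng (gpath l) = gobj (rng l);
  gmorph_src : forall l, src (gpath l) = gobj (src l);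
  gmorph_idp : forall v, gpath (idp v) = idp (gobj v);
  gmorph_comp : forall l m, src l = rng m ->
    gpath (kcomp l m) = kcomp (gpath l) (gpath m);
  gmorph_deg : forall l, kdeg (gpath l) = kdeg l
}.

Section Omega.
Variables (k : nat) (M : ideg k).

Definition omega_vertex : countType := {p : deg k | dlei p M}.
Definition omega_path : countType :=
  {pq : deg k * deg k | dle pq.1 pq.2 && dlei pq.2 M}.
Implicit Types (u w : omega_path) (p : omega_vertex).

Lemma omega_rngP u : dlei (val u).1 M.
Proof. by case/andP: (valP u) => /dle_dlei; exact. Qed.
Lemma omega_srcP u : dlei (val u).2 M.
Proof. by case/andP: (valP u). Qed.
Lemma omega_idP p : dle (val p) (val p) && dlei (val p) M.
Proof. by rewrite dle_refl (valP p). Qed.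

Definition omega_rng u : omega_vertex := Sub (val u).1 (omega_rngP u).
Definition omega_src u : omega_vertex := Sub (val u).2 (omega_srcP u).
Definition omega_id p : omega_path := Sub (val p, val p) (omega_idP p).
(* [insubd] returns [u] when the pair is not a path, in particular only when
   [u] and [w] are not composable *)
Definition omega_comp u w : omega_path := insubd u ((val u).1, (val w).2).
Definition omega_deg u : deg k := dsub (val u).2 (val u).1.

Lemma omega_src_rng u w : omega_src u = omega_rng w -> (val u).2 = (val w).1.
Proof. by move=> /(congr1 val). Qed.

Lemma val_omega_comp u w : omega_src u = omega_rng w ->
  val (omega_comp u w) = ((val u).1, (val w).2).
Proof.
move=> /omega_src_rng e; rewrite val_insubd /=.
case/andP: (valP u) => u12 _; case/andP: (valP w) => w12 wM.
by rewrite wM (dle_trans u12) // e.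
Qed.

Fact omega_rng_idp p : omega_rng (omega_id p) = p.
Proof. exact: val_inj. Qed.
Fact omega_src_idp p : omega_src (omega_id p) = p.
Proof. exact: val_inj. Qed.
Fact omega_rng_comp u w : omega_src u = omega_rng w ->
  omega_rng (omega_comp u w) = omega_rng u.
Proof. by move=> e; apply: val_inj; rewrite /= val_omega_comp. Qed.
Fact omega_src_comp u w : omega_src u = omega_rng w ->
  omega_src (omega_comp u w) = omega_src w.
Proof. by move=> e; apply: val_inj; rewrite /= val_omega_comp. Qed.
Fact omega_comp_idl u : omega_comp (omega_id (omega_rng u)) u = u.
Proof.
apply: val_inj; rewrite val_omega_comp ?omega_src_idp //=.
by case: (val u).
Qed.
Fact omega_comp_idr u : omega_comp u (omega_id (omega_src u)) = u.
Proof.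
apply: val_inj; rewrite val_omega_comp ?omega_rng_idp //=.
by case: (val u).
Qed.
Fact omega_comp_assoc u w z : omega_src u = omega_rng w ->
  omega_src w = omega_rng z ->
  omega_comp u (omega_comp w z) = omega_comp (omega_comp u w) z.
Proof.
move=> uw wz; apply: val_inj.
rewrite !val_omega_comp ?omega_src_comp ?omega_rng_comp //.
Qed.
Fact omega_deg_idp p : omega_deg (omega_id p) = 0.
Proof. exact: dsub_id. Qed.
Fact omega_deg_comp u w : omega_src u = omega_rng w ->
  omega_deg (omega_comp u w) = omega_deg u + omega_deg w.
Proof.
move=> e; rewrite /omega_deg val_omega_comp //=; move/omega_src_rng: e => e.
case/andP: (valP u) => /dleP u12 _; case/andP: (valP w) => /dleP w12 _.
move: u12 w12; rewrite -e => u12 w12.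
apply/ffunP => i; rewrite !ffunE.
by rewrite -(subnK (w12 i)) -(addnBA _ (u12 i)) addnK addnC.
Qed.
Fact omega_factorisation u (m n : deg k) : omega_deg u = m + n ->
  exists! ms : omega_path * omega_path,
    [/\ omega_deg ms.1 = m, omega_deg ms.2 = n,
        omega_src ms.1 = omega_rng ms.2 & u = omega_comp ms.1 ms.2].
Proof.
move=> du; case/andP: (valP u) => u12 uM.
have u2E : (val u).2 = (val u).1 + m + n.
  by rewrite -addrA -du dsubKC.
have le1 : dle ((val u).1 + m) (val u).2 by rewrite u2E dle_addr.
have P1 : dle (val u).1 ((val u).1 + m) && dlei ((val u).1 + m) M.
  by rewrite dle_addr (dle_dlei le1).
have P2 : dle ((val u).1 + m) (val u).2 && dlei (val u).2 M by rewrite le1 uM.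
pose u1 : omega_path := Sub ((val u).1, (val u).1 + m) P1.
pose u2 : omega_path := Sub ((val u).1 + m, (val u).2) P2.
have u1u2 : omega_src u1 = omega_rng u2 by exact: val_inj.
exists (u1, u2); split=> /=.
  split=> //; rewrite /omega_deg /= ?daddK //; first by rewrite u2E daddK.
  by apply: val_inj; rewrite val_omega_comp //=; case: (val u).
move=> [w1 w2] /= [d1 d2 e uE].
have e' := omega_src_rng e.
have vu : val u = ((val w1).1, (val w2).2) by rewrite uE val_omega_comp.
case/andP: (valP w1) => w11 _.
have w1E : (val w1).2 = (val u).1 + m by rewrite -d1 /omega_deg vu /= dsubKC.
have -> : u1 = w1.
  apply: val_inj; rewrite [RHS]surjective_pairing w1E.
  by congr (_, _); rewrite vu.
have -> // : u2 = w2.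
apply: val_inj; rewrite [RHS]surjective_pairing -e' w1E.
by congr (_, _); rewrite vu.
Qed.

Definition Omega : kgraph k := KGraph omega_rng_idp omega_src_idp
  omega_rng_comp omega_src_comp omega_comp_idl omega_comp_idr omega_comp_assoc
  omega_deg_idp omega_deg_comp omega_factorisation.

Definition omega0 : vertex Omega := Sub 0 (dlei0 M).

End Omega.

Section BoundaryPaths.
Variables (k : nat) (L : kgraph k).

Definition is_boundary (M : ideg k) (x : gmorph (Omega M) L) : Prop :=
  exists nx : vertex (Omega M), forall n : vertex (Omega M),
    dle (val nx) (val n) ->
    forall i, M i = Some (val n i) ->
    ~ exists l : L, rng l = gobj x n /\ kdeg l = dunit i.

Record bpath := BPath {
  bdeg : ideg k;
  bmor :> gmorph (Omega bdeg) L;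
  bpathP : is_boundary bmor
}.

HB.instance Definition _ := gen_eqMixin bpath.
HB.instance Definition _ := gen_choiceMixin bpath.

Definition brng (x : bpath) : vertex L := gobj x (omega0 (bdeg x)).

(* x(p, q), or [None] unless p <= q <= d(x) *)
Definition bseg (x : bpath) (p q : deg k) : option L :=
  omap (bmor x) (insub (p, q)).

Definition is_concat (l : L) (x y : bpath) : Prop :=
  [/\ bdeg y = daddi (kdeg l) (bdeg x),
      bseg y 0 (kdeg l) = Some l
    & forall n, dle (kdeg l) n -> dlei n (bdeg y) ->
        bseg y (kdeg l) n = bseg x 0 (dsub n (kdeg l))].

(* If [src l = brng x] there is exactly one y with [is_concat l x y]; otherwise
   the value is irrelevant. *)
Definition concat (l : L) (x : bpath) : bpath := xget x [set y | is_concat l x y].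

End BoundaryPaths.

Section HilbertSpace.
Variables (R : realType) (X : choiceType).
Implicit Types f g : X -> R[i].

Definition sqmod (z : R[i]) : R := complex.Re z ^+ 2 + complex.Im z ^+ 2.

Definition sqsum f : \bar R := \esum_(x in [set: X]) (sqmod (f x))%:E.

Record l2 := L2 { l2_fun :> X -> R[i]; l2P : (sqsum l2_fun < +oo)%E }.

HB.instance Definition _ := gen_eqMixin l2.
HB.instance Definition _ := gen_choiceMixin l2.

Lemma l2_ext (f g : l2) : f =1 g -> f = g.
Proof.
case: f g => f Pf [g Pg] /= /funext fg; move: Pg; rewrite -fg => Pg.
by congr L2; exact: Prop_irrelevance.
Qed.

Lemma sqmod_ge0 (z : R[i]) : 0 <= sqmod z.
Proof. by rewrite addr_ge0 ?sqr_ge0. Qed.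

Lemma sqmodM (a b : R[i]) : sqmod (a * b) = sqmod a * sqmod b.
Proof. by case: a b => [a1 a2] [b1 b2]; rewrite /sqmod /=; ring. Qed.

Lemma sqmodN (a : R[i]) : sqmod (- a) = sqmod a.
Proof. by case: a => [a1 a2]; rewrite /sqmod /=; ring. Qed.

Lemma sqmodD (a b : R[i]) : sqmod (a + b) <= 2 * sqmod a + 2 * sqmod b.
Proof.
case: a b => [a1 a2] [b1 b2]; rewrite /sqmod /= -subr_ge0.
rewrite [leRHS](_ : _ = (a1 - b1) ^+ 2 + (a2 - b2) ^+ 2); last by ring.
by rewrite addr_ge0 ?sqr_ge0.
Qed.

Lemma sqsum_ge0 f : (0 <= sqsum f)%E.
Proof. by apply: esum_ge0 => x _; rewrite lee_fin sqmod_ge0. Qed.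

Lemma sqsumZ_le (a : R[i]) f : (sqsum (a *: f)%R <= (sqmod a)%:E * sqsum f)%E.
Proof.
apply: ge_ereal_sup => _ [A [finA _] <-].
under eq_fsbigr do rewrite /GRing.scale /= sqmodM EFinM.
rewrite -ge0_mule_fsumr; last by move=> x; rewrite lee_fin sqmod_ge0.
apply: lee_wpmul2l; first by rewrite lee_fin sqmod_ge0.
by apply: ereal_sup_ubound; exists A.
Qed.

Lemma sqsumD_le f g : (sqsum (f + g)%R <= 2%:E * (sqsum f + sqsum g))%E.
Proof.
rewrite /sqsum -esumD; try by move=> x _; rewrite lee_fin sqmod_ge0.
apply: ge_ereal_sup => _ [A [finA _] <-].
apply: (@le_trans _ _ (2%:E * \sum_(x \in A) ((sqmod (f x))%:E + (sqmod (g x))%:E))%E).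
  rewrite ge0_mule_fsumr; last by move=> x; rewrite -EFinD lee_fin addr_ge0 ?sqmod_ge0.
  apply: lee_fsum => // x _.
  by rewrite -EFinD -EFinM lee_fin mulrDr sqmodD.
apply: lee_wpmul2l => //.
by apply: ereal_sup_ubound; exists A.
Qed.

Lemma sqsumN f : sqsum (- f) = sqsum f.
Proof. by apply: eq_esum => x _; rewrite sqmodN. Qed.

Lemma sqsum0 : sqsum 0 = 0%E.
Proof. by apply: esum1 => x _; rewrite /sqmod /= expr0n /= addr0. Qed.

Lemma l2_addP (f g : l2) : (sqsum (l2_fun f + l2_fun g)%R < +oo)%E.
Proof.
apply: le_lt_trans (sqsumD_le _ _) _.
by apply: lte_mul_pinfty => //; apply: lte_add_pinfty; exact: l2P.
Qed.

Lemma l2_oppP (f : l2) : (sqsum (- l2_fun f)%R < +oo)%E.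
Proof. by rewrite sqsumN; exact: l2P. Qed.

Lemma l2_scaleP (a : R[i]) (f : l2) : (sqsum (a *: l2_fun f)%R < +oo)%E.
Proof.
apply: le_lt_trans (sqsumZ_le _ _) _.
by apply: lte_mul_pinfty; rewrite ?lee_fin ?sqmod_ge0 //; exact: l2P.
Qed.

Lemma l2_zeroP : (sqsum (0%R : X -> R[i]) < +oo)%E.
Proof. by rewrite sqsum0. Qed.

Implicit Types u v w : l2.

Definition l2_zero := L2 l2_zeroP.
Definition l2_opp u := L2 (l2_oppP u).
Definition l2_add u v := L2 (l2_addP u v).
Definition l2_scale a u := L2 (l2_scaleP a u).

Fact l2_addA : associative l2_add.
Proof. by move=> u v w; apply: l2_ext => x; exact: addrA. Qed.
Fact l2_addC : commutative l2_add.
Proof. by move=> u v; apply: l2_ext => x; exact: addrC. Qed.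
Fact l2_add0 : left_id l2_zero l2_add.
Proof. by move=> u; apply: l2_ext => x; exact: add0r. Qed.
Fact l2_addN : left_inverse l2_zero l2_opp l2_add.
Proof. by move=> u; apply: l2_ext => x; exact: addNr. Qed.

HB.instance Definition _ :=
  GRing.isZmodule.Build l2 l2_addA l2_addC l2_add0 l2_addN.

Fact l2_scaleA a b u : l2_scale a (l2_scale b u) = l2_scale (a * b) u.
Proof. by apply: l2_ext => x; exact: mulrA. Qed.
Fact l2_scale1 : left_id 1 l2_scale.
Proof. by move=> u; apply: l2_ext => x; exact: mul1r. Qed.
Fact l2_scaleDr : right_distributive l2_scale +%R.
Proof. by move=> a u v; apply: l2_ext => x; exact: mulrDr. Qed.
Fact l2_scaleDl u : {morph l2_scale^~ u : a b / a + b}.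
Proof. by move=> a b; apply: l2_ext => x; exact: mulrDl. Qed.

HB.instance Definition _ := GRing.Zmodule_isLmodule.Build R[i] l2
  l2_scaleA l2_scale1 l2_scaleDr l2_scaleDl.

Definition l2norm (f : l2) : R := Num.sqrt (fine (sqsum f)).

(* The sum of an absolutely summable family of reals, resp. of complex
   numbers. *)
Definition rsum (u : X -> R) : R :=
  fine (\esum_(x in [set: X]) ((EFin \o u)^\+ x)%E)
  - fine (\esum_(x in [set: X]) ((EFin \o u)^\- x)%E).
Definition csum (u : X -> R[i]) : R[i] :=
  Complex (rsum (fun x => complex.Re (u x))) (rsum (fun x => complex.Im (u x))).

Definition inner (f g : l2) : R[i] := csum (fun x => f x * conjc (g x)).

Lemma sqsum_delta x : sqsum (fun y => (y == x)%:R : R[i]) = 1%E.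
Proof.
rewrite /sqsum (esumID [set x]); last by move=> y _; rewrite lee_fin sqmod_ge0.
rewrite setTI esum_set1; last by rewrite lee_fin sqmod_ge0.
rewrite setTI esum1 => [|y /eqP/negbTE ->]; last first.
  by rewrite /sqmod /= expr0n /= addr0.
by rewrite adde0 eqxx /sqmod /= expr1n expr0n /= addr0.
Qed.

Lemma l2_basisP x : (sqsum (fun y => (y == x)%:R : R[i]) < +oo)%E.
Proof. by rewrite sqsum_delta ltry. Qed.

Definition l2_basis (x : X) : l2 := L2 (l2_basisP x).

Lemma l2norm_ge0 (f : l2) : 0 <= l2norm f.
Proof. exact: sqrtr_ge0. Qed.

Lemma sqr_l2norm (f : l2) : ((l2norm f) ^+ 2)%:E = sqsum f.
Proof.
rewrite sqr_sqrtr; last by rewrite fine_ge0 // sqsum_ge0.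
by rewrite fineK // ge0_fin_numE ?sqsum_ge0 // l2P.
Qed.

Lemma l2normN (f : l2) : l2norm (- f) = l2norm f.
Proof. by rewrite /l2norm sqsumN. Qed.

Lemma l2norm0 : l2norm 0 = 0.
Proof. by rewrite /l2norm sqsum0 sqrtr0. Qed.

Lemma l2normD_le (f g : l2) : l2norm (f + g) <= 2 * (l2norm f + l2norm g).
Proof.
have f0 := l2norm_ge0 f; have g0 := l2norm_ge0 g.
rewrite -(@ler_pXn2r _ 2) // ?nnegrE ?l2norm_ge0 //; last first.
  by rewrite mulr_ge0 // addr_ge0.
have : (((l2norm (f + g)) ^+ 2)%:E
    <= (2 * ((l2norm f) ^+ 2 + (l2norm g) ^+ 2))%:E)%E.
  have := sqsumD_le (l2_fun f) (l2_fun g).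
  by rewrite -[X in (X <= _)%E](sqr_l2norm (f + g)) -!sqr_l2norm.
by rewrite lee_fin => /le_trans; apply; nra.
Qed.

End HilbertSpace.

Section BoundedOperators.
Variables (R : realType) (X : choiceType).
Local Notation H := (l2 R X).

Definition bounded_linear (T : H -> H) : Prop :=
  linear T /\ exists c : R, forall f, l2norm (T f) <= c * l2norm f.

(* The C*-algebra B(l^2(X)), as a ring under pointwise addition and composition *)
Record bop := Bop { bop_fun :> H -> H; bopP : bounded_linear bop_fun }.

HB.instance Definition _ := gen_eqMixin bop.
HB.instance Definition _ := gen_choiceMixin bop.

Lemma bop_ext (S T : bop) : S =1 T -> S = T.
Proof.
case: S T => S PS [T PT] /= /funext ST; move: PT; rewrite -ST => PT.
by congr Bop; exact: Prop_irrelevance.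
Qed.

Lemma bop_zeroP : bounded_linear (fun=> 0).
Proof.
split=> [a f g|]; first by rewrite scaler0 addr0.
by exists 0 => f; rewrite l2norm0 mul0r.
Qed.

Lemma bop_oneP : bounded_linear id.
Proof. by split=> //; exists 1 => f; rewrite mul1r. Qed.

Lemma bop_oppP (T : bop) : bounded_linear (fun f => - T f).
Proof.
have [linT [c Tc]] := bopP T; split=> [a f g|].
  by rewrite linT opprD scalerN.
by exists c => f; rewrite l2normN.
Qed.

Lemma bop_addP (S T : bop) : bounded_linear (fun f => S f + T f).
Proof.
have [linS [c Sc]] := bopP S; have [linT [d Td]] := bopP T.
split=> [a f g|]; first by rewrite linS linT scalerDr addrACA.
exists (2 * (c + d)) => f; apply: le_trans (l2normD_le _ _) _.
by rewrite -mulrA ler_pM2l // mulrDl lerD.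
Qed.

Lemma bop_mulP (S T : bop) : bounded_linear (S \o T).
Proof.
have [linS [c Sc]] := bopP S; have [linT [d Td]] := bopP T.
split=> [a f g|] /=; first by rewrite linT linS.
exists (`|c| * d) => f; apply: le_trans (Sc _) _.
apply: le_trans (ler_wpM2r (l2norm_ge0 _) (ler_norm c)) _.
by rewrite -mulrA ler_wpM2l.
Qed.

Definition bop_zero := Bop bop_zeroP.
Definition bop_one := Bop bop_oneP.
Definition bop_opp T := Bop (bop_oppP T).
Definition bop_add S T := Bop (bop_addP S T).
Definition bop_mul S T := Bop (bop_mulP S T).

Fact bop_addA : associative bop_add.
Proof. by move=> S T U; apply: bop_ext => f; exact: addrA. Qed.
Fact bop_addC : commutative bop_add.
Proof. by move=> S T; apply: bop_ext => f; exact: addrC. Qed.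
Fact bop_add0 : left_id bop_zero bop_add.
Proof. by move=> S; apply: bop_ext => f; exact: add0r. Qed.
Fact bop_addN : left_inverse bop_zero bop_opp bop_add.
Proof. by move=> S; apply: bop_ext => f; exact: addNr. Qed.

HB.instance Definition _ :=
  GRing.isZmodule.Build bop bop_addA bop_addC bop_add0 bop_addN.

Lemma bopD (T : bop) f g : T (f + g) = T f + T g.
Proof. by have [+ _] := bopP T => /(_ 1 f g); rewrite !scale1r. Qed.

Fact bop_mulA : associative bop_mul.
Proof. by move=> S T U; exact: bop_ext. Qed.
Fact bop_mul1 : left_id bop_one bop_mul.
Proof. by move=> S; exact: bop_ext. Qed.
Fact bop_mulr1 : right_id bop_one bop_mul.
Proof. by move=> S; exact: bop_ext. Qed.
Fact bop_mulDl : left_distributive bop_mul +%R.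
Proof. by move=> S T U; exact: bop_ext. Qed.
Fact bop_mulDr : right_distributive bop_mul +%R.
Proof. by move=> S T U; apply: bop_ext => f /=; exact: bopD. Qed.

HB.instance Definition _ := GRing.Zmodule_isPzRing.Build bop
  bop_mulA bop_mul1 bop_mulr1 bop_mulDl bop_mulDr.

Definition is_adjoint (S T : bop) : Prop :=
  forall f g : H, inner (S f) g = inner f (T g).

(* Every T has exactly one adjoint, so the default value 0 is never used. *)
Definition adjoint (T : bop) : bop := xget 0 [set U | is_adjoint T U].

End BoundedOperators.

Section CuntzKrieger.
Variables (k : nat) (L : kgraph k).

(* Cuntz-Krieger families in a C*-algebra A with involution [star]: of the
   structure of A, only that of a ring with [star] enters the definition.  The
   product in [ck_exhaustive] is taken in every order; the list E is never
   empty, so that the unit of A plays no role. *)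
Record cuntz_krieger (A : pzRingType) (star : A -> A) (t : L -> A) : Prop := {
  ck_pisom : forall l, t l * star (t l) * t l = t l;
  ck_proj : forall v,
    t (idp v) * t (idp v) = t (idp v) /\ star (t (idp v)) = t (idp v);
  ck_orth : forall v w, v <> w -> t (idp v) * t (idp w) = 0;
  ck_mul : forall l m, src l = rng m -> t l * t m = t (kcomp l m);
  ck_min : forall l m,
    star (t l) * t m = \sum_(ab \in min_ext l m) (t ab.1 * star (t ab.2));
  ck_exhaustive : forall v (E : seq L), uniq E -> exhaustive v [set` E] ->
    \prod_(l <- E) (t (idp v) - t l * star (t l)) = 0
}.

Variable R : realType.

Definition path_operators (S : L -> bop R (bpath L)) : Prop :=
  forall l x, S l (l2_basis R x) =
    if src l == brng x then l2_basis R (concat l x) else 0.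

End CuntzKrieger.

(* Main.v *)
(* Every boundary path x is determined by its degree and its initial segments
   x(0, n), and such coherent families of initial segments can be prescribed.
   Hence x |-> lambda x is a partial bijection of the set of boundary paths, and
   S_lambda is the operator which it induces; the adjoint is induced by the
   inverse partial bijection.  The Cuntz-Krieger relations then become pointwise
   statements about paths: (iii) says that if lambda x = mu y then x = alpha w
   and y = beta w for a unique minimal extension (alpha, beta), and (iv) that
   every boundary path with range v starts with an element of E.  A boundary path
   with range v exists: move along a path to a vertex beyond which the set of
   directions admitting no edge no longer grows, then extend forever in all other
   directions. *)
Require Import Defs.
From mathcomp Require Import all_boot all_order all_algebra.
From mathcomp Require Import boolp classical_sets functions cardinality.
From mathcomp Require Import fsbigop reals ereal numfun esum.
From mathcomp Require Import complex zify lra.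

Set Implicit Arguments.
Unset Strict Implicit.
Unset Printing Implicit Defensive.
Import Order.TTheory GRing.Theory Num.Theory.
Local Open Scope classical_set_scope.
Local Open Scope ring_scope.

(** * Degrees and factorisations *)

Section DegreeLemmas.
Variable k : nat.
Implicit Types (m n p : deg k) (M : ideg k).

Lemma dleiP n M :
  reflect (forall i a, M i = Some a -> (n i <= a)%N) (dlei n M).
Proof.
apply: (iffP forallP) => nM i; first by move=> a Ma; have := nM i; rewrite Ma.
by case E: (M i) => [a|//]; exact: nM.
Qed.

Lemma daddE m n i : (m + n) i = (m i + n i)%N.
Proof. by rewrite ffunE. Qed.

Lemma daddI m n p : m + n = m + p -> n = p.
Proof. by move=> e; rewrite -(daddK m n) e daddK. Qed.

Lemma dlei_daddi m n M : dlei (m + n) (daddi m M) = dlei n M.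
Proof.
apply: eq_forallb => i; rewrite !ffunE; case: (M i) => //= a.
exact: leq_add2l.
Qed.

Lemma dlei_dsub m n M : dlei n (daddi m M) -> dlei (dsub n m) M.
Proof.
move=> /dleiP nM; apply/dleiP => i a Ma; rewrite ffunE.
have := nM i; rewrite ffunE Ma /= => /(_ _ erefl); rewrite leq_subLR; exact.
Qed.

End DegreeLemmas.

Section Factorisation.
Variables (k : nat) (L : kgraph k).
Implicit Types (a b l m : L) (n p q : deg k).

(** Cancellation, the form in which uniqueness of factorisation is used below: equal products force
    [kdeg b = kdeg b'] by cancelling in N^k, so both pairs factor one path at the same degrees. *)
Lemma kcomp_inj a b a' b' : src a = rng b -> src a' = rng b' ->
  kdeg a = kdeg a' -> kcomp a b = kcomp a' b' -> a = a' /\ b = b'.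
Proof.
move=> ab ab' d e.
have [w [_ uniq_ms]] := factorisation (deg_comp ab).
have db : kdeg b' = kdeg b.
  by have := congr1 (@kdeg _ L) e; rewrite !deg_comp // d => /daddI ->.
have h1 := uniq_ms (a, b) (And4 erefl erefl ab erefl).
have h2 := uniq_ms (a', b') (And4 (esym d) db ab' e).
by have := etrans (esym h1) h2; case.
Qed.

(** A chosen factorisation of [l] at degree [n]; the degree of the second factor is then determined.
    The default [(l, l)] is taken only when [n] is not below [kdeg l]. *)
Definition ksplit n l : L * L :=
  xget (l, l) [set ms | [/\ kdeg ms.1 = n, src ms.1 = rng ms.2
                          & l = kcomp ms.1 ms.2]].
Definition kinit n l := (ksplit n l).1.
Definition ktail n l := (ksplit n l).2.

Lemma ksplitP n l : dle n (kdeg l) ->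
  [/\ kdeg (kinit n l) = n, src (kinit n l) = rng (ktail n l)
    & l = kcomp (kinit n l) (ktail n l)].
Proof.
move=> nl; rewrite /kinit /ktail /ksplit; case: xgetP => [_ -> //|none].
have [ms [[d1 _ e lE] _]] := factorisation (esym (dsubKC nl)).
by case: (none ms).
Qed.

Lemma kinit_eq a b : src a = rng b -> kinit (kdeg a) (kcomp a b) = a.
Proof.
move=> ab; have [|d e E] := @ksplitP (kdeg a) (kcomp a b).
  by rewrite deg_comp // dle_addr.
by have [] := kcomp_inj e ab d (esym E).
Qed.

Lemma rng_kinit n l : dle n (kdeg l) -> rng (kinit n l) = rng l.
Proof. by move=> /ksplitP[d e E]; rewrite [in RHS]E rng_comp. Qed.

(** Factoring [a] at degree [n] and reassociating factors [kcomp a b] at degree [n] with the same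
    first factor. *)
Lemma kinit_comp n a b : src a = rng b -> dle n (kdeg a) ->
  kinit n (kcomp a b) = kinit n a.
Proof.
move=> ab /ksplitP[d e E].
have e' : src (ktail n a) = rng b by rewrite -ab [in RHS]E src_comp.
rewrite {1}E -comp_assoc //.
have := @kinit_eq (kinit n a) (kcomp (ktail n a) b).
by rewrite d rng_comp //; apply.
Qed.

Lemma kinitK p q l : dle p q -> dle q (kdeg l) ->
  kinit p (kinit q l) = kinit p l.
Proof.
move=> pq /ksplitP[d e E].
by rewrite [in RHS]E kinit_comp // d.
Qed.

Lemma kinit_id l : kinit (kdeg l) l = l.
Proof. by have := kinit_eq (esym (rng_idp (src l))); rewrite comp_idr. Qed.

End Factorisation.

(** * Segments of boundary paths, and reconstruction from initial segments *)

Section Segments.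
Variables (k : nat) (L : kgraph k).
Implicit Types (x y : bpath L) (l m : L) (n p q : deg k) (M : ideg k).

(** The segment x(p, q) as a total function of plain degrees, which avoids carrying membership
    proofs; the default is taken only when p <= q <= d(x) fails. *)
Definition seg x p q : L := odflt (idp (brng x)) (bseg x p q).
(** The vertex x(p), recovered from an initial segment so that it too is defined on plain
    degrees. *)
Definition bvtx x p : vertex L := src (seg x 0 p).

Section OmegaPath.
Variables (M : ideg k) (p q : deg k) (pq : dle p q) (qM : dlei q M).

Lemma opathP : dle (p, q).1 (p, q).2 && dlei (p, q).2 M.
Proof. by rewrite pq. Qed.

Definition opath : Omega M := Sub (p, q) opathP.

End OmegaPath.

Lemma bsegE x p q (pq : dle p q) (qM : dlei q (bdeg x)) :
  bseg x p q = Some (bmor x (opath pq qM)).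
Proof. by rewrite /bseg -[(p, q)]/(val (opath pq qM)) valK. Qed.

Lemma bsegS x p q : dle p q -> dlei q (bdeg x) -> bseg x p q = Some (seg x p q).
Proof. by move=> pq qM; rewrite /seg bsegE. Qed.

Lemma segE x p q (pq : dle p q) (qM : dlei q (bdeg x)) :
  seg x p q = bmor x (opath pq qM).
Proof. by rewrite /seg bsegE. Qed.

Lemma seg_omega x (u : Omega (bdeg x)) :
  bmor x u = seg x (val u).1 (val u).2.
Proof.
have [pq qM] := andP (valP u).
rewrite (segE pq qM); congr (bmor x _); apply: val_inj => /=.
by case: (val u).
Qed.

Lemma gobjE x (n : vertex (Omega (bdeg x))) : gobj x n = bvtx x (val n).
Proof.
rewrite /bvtx (segE (dle0 _) (valP n)) gmorph_src; congr gobj.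
exact: val_inj.
Qed.

Lemma seg_deg x p q : dle p q -> dlei q (bdeg x) -> kdeg (seg x p q) = dsub q p.
Proof. by move=> pq qM; rewrite segE gmorph_deg. Qed.

Lemma seg0_deg x q : dlei q (bdeg x) -> kdeg (seg x 0 q) = q.
Proof.
move=> qM; rewrite seg_deg ?dle0 //; apply/ffunP => i.
by rewrite !ffunE subn0.
Qed.

Lemma seg_rng x p q : dle p q -> dlei q (bdeg x) -> rng (seg x p q) = bvtx x p.
Proof.
move=> pq qM; rewrite segE gmorph_rng.
exact: (@gobjE x (omega_rng (opath pq qM))).
Qed.

Lemma seg_src x p q : dle p q -> dlei q (bdeg x) -> src (seg x p q) = bvtx x q.
Proof.
move=> pq qM; rewrite segE gmorph_src.
exact: (@gobjE x (omega_src (opath pq qM))).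
Qed.

Lemma seg_comp x p q n : dle p q -> dle q n -> dlei n (bdeg x) ->
  kcomp (seg x p q) (seg x q n) = seg x p n.
Proof.
move=> pq qn nM; have qM := dle_dlei qn nM.
rewrite (segE pq qM) (segE qn nM) (segE (dle_trans pq qn) nM).
have e : src (opath pq qM) = rng (opath qn nM) by exact: val_inj.
rewrite -gmorph_comp //; congr (bmor x _).
by apply: val_inj; rewrite val_omega_comp.
Qed.

Lemma seg_id x p : dlei p (bdeg x) -> seg x p p = idp (bvtx x p).
Proof.
move=> pM; rewrite (segE (dle_refl p) pM).
have -> : opath (dle_refl p) pM = idp (Sub p pM : vertex (Omega (bdeg x))).
  exact: val_inj.
by rewrite gmorph_idp gobjE.
Qed.

Lemma brngE x : brng x = bvtx x 0.
Proof. by rewrite /brng gobjE. Qed.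

Lemma seg0_rng x q : dlei q (bdeg x) -> rng (seg x 0 q) = brng x.
Proof. by move=> qM; rewrite seg_rng ?dle0 // brngE. Qed.

Lemma kinit_seg x p q n : dle p q -> dle q n -> dlei n (bdeg x) ->
  kinit (dsub q p) (seg x p n) = seg x p q.
Proof.
move=> pq qn nM; have qM := dle_dlei qn nM.
rewrite -(seg_comp pq qn nM) -(seg_deg pq qM) kinit_eq //.
by rewrite seg_src // seg_rng.
Qed.

Lemma kinit_seg0 x q n : dle q n -> dlei n (bdeg x) ->
  kinit q (seg x 0 n) = seg x 0 q.
Proof.
move=> qn nM; rewrite -(kinit_seg (dle0 q) qn nM); congr kinit.
by apply/ffunP => i; rewrite !ffunE subn0.
Qed.

Lemma gmorph_ext (K K' : kgraph k) (f g : gmorph K K') :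
  gobj f =1 gobj g -> gpath f =1 gpath g -> f = g.
Proof.
case: f => fo fp a b c d e; case: g => go gp a' b' c' d' e' /=.
move=> /funext E1 /funext E2; subst go gp.
by congr GMorph; exact: Prop_irrelevance.
Qed.

(** Cancelling x(0, p) from x(0, q) = x(0, p) x(p, q) recovers every segment, and vertices are
    sources of initial segments. The degrees are identified first, since the type of [bmor] depends
    on them. *)
Lemma bpath_ext x y : bdeg x = bdeg y ->
  (forall n, dlei n (bdeg x) -> seg x 0 n = seg y 0 n) -> x = y.
Proof.
case: x => M x Hx; case: y => M' y Hy /= E; subst M' => sxy.
have sxy' p q : dle p q -> dlei q M -> seg (BPath Hx) p q = seg (BPath Hy) p q.
  move=> pq qM; have pM := dle_dlei pq qM.
  have [] // := @kcomp_inj _ L (seg (BPath Hx) 0 p) (seg (BPath Hx) p q)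
    (seg (BPath Hy) 0 p) (seg (BPath Hy) p q).
  - by rewrite [RHS]seg_rng.
  - by rewrite [RHS]seg_rng.
  - by rewrite sxy.
  - by rewrite !seg_comp ?dle0 // sxy.
have E : x = y.
  apply: gmorph_ext => [n|u].
    rewrite (@gobjE (BPath Hx) n) (@gobjE (BPath Hy) n) /bvtx sxy //.
    exact: (valP n).
  rewrite (@seg_omega (BPath Hx) u) (@seg_omega (BPath Hy) u) /=.
  by have [pq qM] := andP (valP u); exact: sxy'.
by subst y; congr BPath; exact: Prop_irrelevance.
Qed.

Definition stuck (v : vertex L) (i : 'I_k) : Prop :=
  ~ exists l : L, rng l = v /\ kdeg l = dunit i.

Lemma bpath_stuck x : exists2 nx, dlei nx (bdeg x) &
  forall n, dle nx n -> dlei n (bdeg x) ->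
    forall i, bdeg x i = Some (n i) -> stuck (bvtx x n) i.
Proof.
have [nx H] := bpathP x; exists (val nx); first exact: (valP nx).
move=> n nxn nM i Mi.
by have := H (Sub n nM) nxn i Mi; rewrite gobjE.
Qed.

(** All boundary paths below are built with this. The first two hypotheses make the prefixes
    coherent, and functoriality then follows by cancelling a common prefix; the third is the
    boundary condition. *)
Lemma bpath_of_prefixes M (P : deg k -> L) :
  (forall n, dlei n M -> kdeg (P n) = n) ->
  (forall p q, dle p q -> dlei q M -> kinit p (P q) = P p) ->
  (exists2 nx, dlei nx M & forall n, dle nx n -> dlei n M ->
    forall i, M i = Some (n i) -> stuck (src (P n)) i) ->
  exists2 x : bpath L, bdeg x = M & forall n, dlei n M -> seg x 0 n = P n.
Proof.
move=> degP initP [nx nxM Hnx].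
have PP p q : dle p q -> dlei q M -> src (P p) = rng (ktail p (P q)) /\
    P q = kcomp (P p) (ktail p (P q)).
  move=> pq qM; have := @ksplitP _ L p (P q).
  by rewrite degP // initP // => /(_ pq)[].
pose go (p : vertex (Omega M)) := src (P (val p)).
(* x(p, q) is what remains of [P q] after its initial segment [P p]. *)
pose gp (u : Omega M) := ktail (val u).1 (P (val u).2).
have uP (u : Omega M) : src (P (val u).1) = rng (gp u) /\
    P (val u).2 = kcomp (P (val u).1) (gp u).
  by have [pq qM] := andP (valP u); exact: PP.
have h1 u : rng (gp u) = go (rng u) by have [] := uP u.
have h2 u : src (gp u) = go (src u).
  have [a b] := uP u; have := congr1 (@src _ L) b.
  by rewrite src_comp //= => <-.
have h3 v : gp (idp v) = idp (go v).
  have [a b] := uP (idp v).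
  have [] // := kcomp_inj a _ erefl (etrans (esym b) (esym (comp_idr _))).
  by rewrite rng_idp.
have h4 u w : src u = rng w -> gp (kcomp u w) = kcomp (gp u) (gp w).
  move=> e; have e' := omega_src_rng e.
  have [a b] := uP u; have [a' b'] := uP w.
  have [c d] := uP (kcomp u w).
  move: c d; rewrite /= (val_omega_comp e) /= => c d.
  have e2 : src (gp u) = rng (gp w) by rewrite h2 h1 e.
  (* Both sides of the functoriality equation, preceded by [P (val u).1], equal [P (val w).2]. *)
  have := d; rewrite {1}b' -{1}e' b -comp_assoc // => d'.
  have [] // := kcomp_inj _ c erefl d'.
  by rewrite rng_comp.
have h5 u : kdeg (gp u) = kdeg u.
  have [pq qM] := andP (valP u).
  have [a b] := uP u; have := congr1 (@kdeg _ L) b.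
  rewrite deg_comp // !degP //; last exact: dle_dlei qM.
  by rewrite /= /omega_deg => ->; rewrite daddK.
pose x0 := GMorph h1 h2 h3 h4 h5.
have Hx0 : is_boundary x0.
  exists (Sub nx nxM) => n nxn i Mi; apply: (Hnx (val n)) => //.
  exact: (valP n).
exists (BPath Hx0) => // n nM.
have nM' : dlei n (bdeg (BPath Hx0)) by [].
rewrite (segE (dle0 n) nM') /= /gp /=.
have [e E] := PP _ _ (dle0 n) nM.
have d0 : kdeg (P 0) = 0 by rewrite degP // dlei0.
rewrite [RHS]E.
(* A path of degree 0 is a vertex: compare its two trivial factorisations, with an identity on the
   right and on the left. *)
have P0 : P 0 = idp (rng (P 0)).
  have [] // := @kcomp_inj _ L (P 0) (idp (src (P 0))) (idp (rng (P 0))) (P 0).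
  - by rewrite rng_idp.
  - by rewrite src_idp.
  - by rewrite deg_idp.
  - by rewrite comp_idl comp_idr.
have : src (P 0) = rng (P 0) by rewrite P0 src_idp rng_idp.
by rewrite e => e'; rewrite P0 -e' comp_idl.
Qed.

End Segments.

(** * Concatenation of boundary paths *)

Section Concatenation.
Variables (k : nat) (L : kgraph k).
Implicit Types (x y z : bpath L) (l m : L) (n p q : deg k) (M : ideg k).

Lemma dlei_kdeg l x y : bdeg y = daddi (kdeg l) (bdeg x) ->
  dlei (kdeg l) (bdeg y).
Proof.
move=> ->; apply/dleiP => i a; rewrite ffunE.
by case: (bdeg x i) => //= b [<-]; exact: leq_addr.
Qed.

Lemma is_concatP l x y : is_concat l x y <->
  [/\ bdeg y = daddi (kdeg l) (bdeg x), src l = brng x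
    & forall n, dlei n (bdeg x) -> seg y 0 (kdeg l + n) = kcomp l (seg x 0 n)].
Proof.
split.
  move=> [dy yl yx]; have lM := dlei_kdeg dy.
  have sl : seg y 0 (kdeg l) = l by rewrite /seg yl.
  have sx n : dlei n (bdeg x) -> seg y (kdeg l) (kdeg l + n) = seg x 0 n.
    move=> nM; have nM' : dlei (kdeg l + n) (bdeg y) by rewrite dy dlei_daddi.
    have := yx _ (dle_addr _ _) nM'.
    by rewrite daddK !bsegS ?dle0 ?dle_addr // => -[].
  split=> //.
    rewrite -(seg0_rng (dlei0 _)) -sx ?dlei0 // addr0 seg_rng ?dle_refl //.
    by rewrite /bvtx sl.
  move=> n nM; rewrite -sx // -{2}sl seg_comp ?dle0 ?dle_addr //.
  by rewrite dy dlei_daddi.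
move=> [dy slx yx]; have lM := dlei_kdeg dy.
have sl : seg y 0 (kdeg l) = l.
  have := yx 0 (dlei0 _); rewrite addr0 => ->.
  by rewrite seg_id ?dlei0 // -brngE -slx comp_idr.
split=> //; first by rewrite bsegS ?dle0 // sl.
move=> n ln nM; have nM' : dlei (dsub n (kdeg l)) (bdeg x).
  by apply: dlei_dsub; rewrite -dy.
rewrite !bsegS ?dle0 //; congr Some.
have := yx _ nM'; rewrite dsubKC // -(seg_comp (dle0 _) ln nM) sl.
move=> /kcomp_inj[] //; first by rewrite seg_rng // /bvtx sl.
by rewrite seg0_rng.
Qed.

Lemma is_concat_seg l x y : is_concat l x y -> seg y 0 (kdeg l) = l.
Proof. by move=> [_ yl _]; rewrite /seg yl. Qed.

Lemma is_concat_dlei l x y : is_concat l x y -> dlei (kdeg l) (bdeg y).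
Proof. by move=> [dy _ _]; exact: dlei_kdeg dy. Qed.

Lemma is_concat_src l x y : is_concat l x y -> src l = brng x.
Proof. by move=> /is_concatP[]. Qed.

Lemma is_concat_rng l x y : is_concat l x y -> brng y = rng l.
Proof.
by move=> c; rewrite -(is_concat_seg c) seg0_rng // (is_concat_dlei c).
Qed.

Lemma is_concat_fun l x y y' : is_concat l x y -> is_concat l x y' -> y = y'.
Proof.
move=> /is_concatP[dy sl yx] /is_concatP[dy' _ yx'].
apply: bpath_ext => [|n nM]; first by rewrite dy dy'.
have nx : dlei (dsub n (kdeg l)) (bdeg x) by apply: dlei_dsub; rewrite -dy.
(* Only prefixes of degree at least [kdeg l] are prescribed. Subtraction being truncated, this sum
   is the join of [n] and [kdeg l], and the prefix of degree [n] is cut from that one. *)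
have nn : dle n (kdeg l + dsub n (kdeg l)).
  by apply/dleP => i; rewrite ?daddE !ffunE; lia.
rewrite -(kinit_seg0 nn) ?dy ?dlei_daddi // yx //.
by rewrite -yx' // kinit_seg0 ?dy' ?dlei_daddi.
Qed.

Lemma is_concat_inj l x x' y : is_concat l x y -> is_concat l x' y -> x = x'.
Proof.
move=> /is_concatP[dy sl yx] /is_concatP[dy' sl' yx'].
have dxx' : bdeg x = bdeg x'.
  apply/ffunP => i; have := congr1 (fun f : ideg k => f i) dy.
  rewrite dy' !ffunE; case: (bdeg x i) => [a|]; case: (bdeg x' i) => [b|] //=.
  by move=> -[/addnI ->].
apply: bpath_ext => // n nM.
have nM' : dlei n (bdeg x') by rewrite -dxx'.
have := yx _ nM; rewrite yx' // => /kcomp_inj[] //; by rewrite seg0_rng.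
Qed.

(* The degree of [Q n] is [djoin (kdeg l) n]; truncating it to degree n makes
   sense for every n, above [kdeg l] or not. *)
Lemma is_concat_exists l x : src l = brng x -> exists y, is_concat l x y.
Proof.
move=> lx; pose M := daddi (kdeg l) (bdeg x).
pose Q n := kcomp l (seg x 0 (dsub n (kdeg l))).
have lQ n : dlei n M -> src l = rng (seg x 0 (dsub n (kdeg l))).
  by move=> nM; rewrite seg0_rng // dlei_dsub.
have dQ n : dlei n M -> kdeg (Q n) = kdeg l + dsub n (kdeg l).
  by move=> nM; rewrite (deg_comp (lQ _ nM)) seg0_deg // dlei_dsub.
have leQ n : dle n (kdeg l + dsub n (kdeg l)).
  by apply/dleP => i; rewrite ?daddE !ffunE; lia.
have Qge n : dlei n M -> dle (kdeg l) n -> kinit n (Q n) = Q n.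
  by move=> nM ln; rewrite -{1}(dsubKC ln) -dQ // kinit_id.
have [|||y dy yP] := @bpath_of_prefixes k L M (fun n => kinit n (Q n)).
- move=> n nM; have [] // := @ksplitP _ L n (Q n).
  by rewrite dQ.
- move=> p q pq qM; have pM := dle_dlei pq qM.
  rewrite kinitK // ?dQ //.
  have dpq : dle (dsub p (kdeg l)) (dsub q (kdeg l)).
    by apply/dleP => i; rewrite ?daddE !ffunE; move/dleP: pq => /(_ i); lia.
  rewrite /Q -(seg_comp (dle0 _) dpq) ?dlei_dsub //.
  have e : src (seg x 0 (dsub p (kdeg l))) =
      rng (seg x (dsub p (kdeg l)) (dsub q (kdeg l))).
    by rewrite seg_rng ?dlei_dsub.
  rewrite (comp_assoc (lQ _ pM) e) kinit_comp ?(src_comp (lQ _ pM)) //.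
  by rewrite [kdeg _]dQ.
- have [nx nxM H] := bpath_stuck x.
  exists (kdeg l + nx); first by rewrite dlei_daddi.
  move=> n nxn nM i Mi; have ln := dle_trans (dle_addr _ _) nxn.
  rewrite Qge // (src_comp (lQ _ nM)); apply: H.
  + by rewrite -(dle_add2l (kdeg l)) dsubKC.
  + exact: dlei_dsub.
  + move: Mi; rewrite !ffunE; case: (bdeg x i) => //= a [<-].
    by rewrite addKn.
exists y; apply/is_concatP; split=> // n nM.
by rewrite yP ?dlei_daddi // Qge ?dle_addr ?dlei_daddi // /Q daddK.
Qed.

(** The tail has initial segments x(0, n) = y(p, p + n) and degree d(y) - p, an infinite coordinate
    staying infinite. *)
Lemma is_concat_tail y p : dlei p (bdeg y) ->
  exists x, is_concat (seg y 0 p) x y.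
Proof.
move=> pM; pose M : ideg k := [ffun i => omap (subn^~ (p i)) (bdeg y i)].
have yM : bdeg y = daddi p M.
  apply/ffunP => i; rewrite !ffunE; move/dleiP: pM => /(_ i).
  by case: (bdeg y i) => //= a /(_ _ erefl) pa; rewrite subnKC.
have [|||x dx xP] := @bpath_of_prefixes k L M (fun n => seg y p (p + n)).
- by move=> n nM; rewrite seg_deg ?dle_addr ?yM ?dlei_daddi // daddK.
- move=> q n qn nM; rewrite -{1}(daddK p q) kinit_seg ?dle_addr ?dle_add2l //.
  by rewrite yM dlei_daddi.
- have [ny nyM H] := bpath_stuck y.
  (* Truncation does no harm: n >= [dsub ny p] gives p + n >= [ny] in every coordinate. *)
  exists (dsub ny p); first by apply: dlei_dsub; rewrite -yM.
  move=> n nxn nM i Mi; rewrite seg_src ?dle_addr ?yM ?dlei_daddi //.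
  apply: H; rewrite ?yM ?dlei_daddi //.
    by apply/dleP => j; move/dleP: nxn => /(_ j); rewrite ?daddE !ffunE; lia.
  by rewrite ffunE Mi /= ffunE.
exists x; apply/is_concatP; rewrite seg0_deg // dx; split=> //.
  rewrite -(seg0_rng (dlei0 _)) xP ?dlei0 // addr0 seg_id //.
  by rewrite rng_idp.
by move=> n nM; rewrite xP // seg_comp ?dle0 ?dle_addr // yM dlei_daddi.
Qed.

Lemma is_concat_idp v x y : is_concat (idp v) x y <-> x = y /\ brng x = v.
Proof.
have c x' : brng x' = v -> is_concat (idp v) x' x'.
  move=> <-; apply/is_concatP; rewrite deg_idp; split.
  - by apply/ffunP => i; rewrite !ffunE; case: (bdeg x' i).
  - exact: src_idp.
  - by move=> n nM; rewrite add0r -(seg0_rng nM) comp_idl.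
split=> [cxy|[<- /c//]].
have xv : brng x = v by rewrite -(is_concat_src cxy) src_idp.
by split=> //; exact: is_concat_fun (c _ xv) cxy.
Qed.

Lemma is_concat_trans l m x y z : is_concat m x y -> is_concat l y z ->
  is_concat (kcomp l m) x z.
Proof.
move=> cm cl; have lm : src l = rng m.
  by rewrite (is_concat_src cl) (is_concat_rng cm).
move: cm cl => /is_concatP[dy mx yx] /is_concatP[dz ly zy].
apply/is_concatP; rewrite deg_comp //; split.
- rewrite dz dy; apply/ffunP => i; rewrite !ffunE.
  by case: (bdeg x i) => //= a; rewrite addnA.
- by rewrite src_comp.
- move=> n nM; rewrite -addrA zy ?dy ?dlei_daddi // yx // comp_assoc //.
  by rewrite seg0_rng.
Qed.

(** Build m x and then l (m x) by existence; the result is [z] because concatenation is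
    single-valued. *)
Lemma is_concat_comp l m x z : src l = rng m ->
  is_concat (kcomp l m) x z -> exists2 y, is_concat m x y & is_concat l y z.
Proof.
move=> lm c; have mx : src m = brng x by rewrite -(is_concat_src c) src_comp.
have [y my] := is_concat_exists mx.
have ly : src l = brng y by rewrite (is_concat_rng my).
have [z' lz'] := is_concat_exists ly.
exists y => //; suff -> : z = z' by [].
exact: is_concat_fun c (is_concat_trans my lz').
Qed.

Lemma is_concat_deg_inj l l' x x' y : is_concat l x y -> is_concat l' x' y ->
  kdeg l = kdeg l' -> l = l'.
Proof.
by move=> /is_concat_seg c /is_concat_seg c' e; rewrite -c -c' e.
Qed.

(** Cut z at the join n of the two degrees: the extension consists of z(d(l), n) and z(d(m), n), and
    w is the tail of z after n. *)
Lemma is_concat_min_ext l m x y z : is_concat l x z -> is_concat m y z ->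
  exists ab w, [/\ min_ext l m ab, is_concat ab.1 w x & is_concat ab.2 w y].
Proof.
move=> cl cm; have lM := is_concat_dlei cl; have mM := is_concat_dlei cm.
pose n := djoin (kdeg l) (kdeg m).
have nM : dlei n (bdeg z).
  move/dleiP: lM => lM; move/dleiP: mM => mM.
  by apply/dleiP => i a za; rewrite ffunE geq_max (lM i) ?(mM i).
have ln : dle (kdeg l) n by apply/dleP => i; rewrite ffunE leq_maxl.
have mn : dle (kdeg m) n by apply/dleP => i; rewrite ffunE leq_maxr.
have [w cw] := is_concat_tail nM.
have key l' x' : is_concat l' x' z -> dle (kdeg l') n ->
    [/\ src l' = rng (seg z (kdeg l') n),
        seg z 0 n = kcomp l' (seg z (kdeg l') n)
      & is_concat (seg z (kdeg l') n) w x'].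
  move=> c l'n; have sl := is_concat_seg c.
  have e : src l' = rng (seg z (kdeg l') n) by rewrite seg_rng // /bvtx sl.
  have E : seg z 0 n = kcomp l' (seg z (kdeg l') n).
    by rewrite -{1}sl seg_comp ?dle0.
  split=> //; rewrite E in cw.
  have [x'' c1 c2] := is_concat_comp e cw.
  by rewrite (is_concat_inj c c2).
have [e1 E1 c1] := key _ _ cl ln; have [e2 E2 c2] := key _ _ cm mn.
exists (seg z (kdeg l) n, seg z (kdeg m) n), w; split=> //.
by split=> //=; rewrite -E1 // seg0_deg.
Qed.

Lemma min_ext_concat l m (ab : L * L) x y w : min_ext l m ab ->
  is_concat ab.1 w x -> is_concat ab.2 w y ->
  exists2 z, is_concat l x z & is_concat m y z.
Proof.
case=> la mb E _ ca cb.
have [z cl] := is_concat_exists (etrans la (esym (is_concat_rng ca))).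
exists z => //; have := is_concat_trans ca cl; rewrite E.
move=> /(is_concat_comp mb)[y' c1 c2].
by rewrite (is_concat_fun cb c1).
Qed.

(** Since this degree depends only on [l] and [m], a given boundary path starts with the first
    component of at most one minimal extension. *)
Lemma min_ext_deg l m (ab : L * L) : min_ext l m ab ->
  kdeg ab.1 = dsub (djoin (kdeg l) (kdeg m)) (kdeg l).
Proof. by case=> la mb E; rewrite deg_comp // => <-; rewrite daddK. Qed.

(* Cut x at the degree n which, in each direction, is either that of x or at
   least those of E and of [bpath_stuck].  The path of E compatible with
   [seg x 0 n] cannot exceed n in a direction of the first kind, because x is
   stuck there, so it is an initial segment of x. *)
Lemma exhaustive_concat v (E : seq L) x : exhaustive v [set` E] ->
  brng x = v -> exists2 l, l \in E & exists y, is_concat l y x.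
Proof.
move=> [Ev exhE] xv; have [nx nxM stuckx] := bpath_stuck x.
pose b i := maxn (nx i) (\max_(l <- E) kdeg l i).
pose n : deg k := [ffun i => if bdeg x i is Some a then minn a (b i) else b i].
have nM : dlei n (bdeg x).
  by apply/dleiP => i a Ma; rewrite ffunE Ma geq_minl.
have nxn : dle nx n.
  apply/dleP => i; rewrite ffunE; move/dleiP: nxM => /(_ i).
  have nxb : (nx i <= b i)%N by exact: leq_maxl.
  by case: (bdeg x i) => // a /(_ _ erefl) nxa; rewrite leq_min nxa.
have rngn : rng (seg x 0 n) = v by rewrite seg0_rng.
have [l lE [[a c] [/= la nc e dlac]]] := exhE _ rngn.
rewrite seg0_deg // in dlac.
exists l => //.
have dc : kdeg (kcomp (seg x 0 n) c) = n + kdeg c.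
  by rewrite deg_comp // seg0_deg.
have ln : dle (kdeg l) n.
  apply/dleP => i; rewrite leqNgt; apply/negP => nl.
  have lb : (kdeg l i <= b i)%N.
    rewrite /b leq_max; apply/orP; right.
    by apply: (@leq_bigmax_seq _ _ predT (fun l : L => kdeg l i)).
  (* As n_i < d(l)_i <= b_i, the coordinate n_i is not b_i, so it is the finite degree of x. *)
  have Mi : bdeg x i = Some (n i).
    move: nl lb; rewrite ffunE; case: (bdeg x i) => [M|] nl lb; last first.
      by move: nl; rewrite ltnNge lb.
    move: nl; rewrite gtn_min => /orP[Ml|]; last by rewrite ltnNge lb.
    by rewrite (minn_idPl (ltnW (leq_trans Ml lb))).
  apply: (stuckx n nxn nM i Mi).
  (* The common extension has i-th degree max(d(l)_i, n_i) > n_i, so [c] begins with an edge in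
     direction i at x(n), where x is stuck. *)
  have ic : dle (dunit i) (kdeg c).
    apply/dleP => j; rewrite ffunE; case: eqP => //= ->.
    have := congr1 (fun f : deg k => f i) dlac.
    rewrite e dc daddE [djoin _ _ _]ffunE => E1.
    by rewrite -(ltn_add2l (n i)) addn0 E1 leq_max nl.
  have [d _ _] := ksplitP ic.
  by exists (kinit (dunit i) c); rewrite rng_kinit // -nc seg_src ?dle0.
have -> : l = seg x 0 (kdeg l).
  rewrite -(kinit_seg0 ln nM) -[LHS](kinit_eq la) e kinit_comp //.
  by rewrite seg0_deg.
by apply: is_concat_tail; exact: dle_dlei ln nM.
Qed.

End Concatenation.

(** * Existence of boundary paths with a given range *)

Section Existence.
Variables (k : nat) (L : kgraph k).
Implicit Types (l m : L) (v w : vertex L) (n : deg k).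

Definition stuck_set v : {set 'I_k} := [set i | `[< stuck v i >]]%SET.

Lemma stuck_setP v i : reflect (stuck v i) (i \in stuck_set v).
Proof. by rewrite inE; exact: asboolP. Qed.

(* An edge e at [src m] yields one at [rng m]: factor [kcomp m e] starting with
   degree [dunit i]. *)
Lemma stuck_set_sub m : stuck_set (rng m) \subset stuck_set (src m).
Proof.
apply/fintype.subsetP => i /stuck_setP si; apply/stuck_setP => -[e [em de]].
apply: si.
have ie : dle (dunit i) (kdeg (kcomp m e)).
  by rewrite deg_comp // de addrC dle_addr.
exists (kinit (dunit i) (kcomp m e)).
by have [d _ _] := ksplitP ie; rewrite rng_kinit // rng_comp.
Qed.

Definition stable (I : {set 'I_k}) v : Prop :=
  forall m, rng m = v -> stuck_set (src m) = I.

Lemma stable_stuck_set I v : stable I v -> stuck_set v = I.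
Proof. by move=> /(_ (idp v)); rewrite rng_idp src_idp; apply. Qed.

Lemma stable_src I m : stable I (rng m) -> stable I (src m).
Proof.
move=> sI l lm; have e : src m = rng l by rewrite lm.
by rewrite -(src_comp e); apply: sI; rewrite rng_comp.
Qed.

(* [stuck_set] grows along paths, so it is eventually constant. *)
Lemma exists_stable v : exists2 l, rng l = v & stable (stuck_set (src l)) (src l).
Proof.
have [j] := ubnP (k - #|stuck_set v|); elim: j => // j IH in v *.
move=> jv; have [st|] := pselect (stable (stuck_set v) v).
  by exists (idp v); rewrite ?rng_idp ?src_idp.
move=> /existsNP[m] /not_implyP[mv nst].
have sub : stuck_set v \proper stuck_set (src m).
  rewrite finset.properEneq -{2}mv stuck_set_sub andbT.
  by apply/eqP => /esym.
have [|l lm st] := IH (src m).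
  have := proper_card sub; have := max_card (stuck_set (src m)).
  by rewrite card_ord; move: jv; lia.
have e : src m = rng l by rewrite lm.
by exists (kcomp m l); rewrite ?rng_comp ?src_comp.
Qed.

(** Induction on the total degree: a direction with n_i > 0 lies outside I, hence admits an edge at
    [v], and the source of that edge is again stable. *)
Lemma stable_path I v n : stable I v -> (forall i, i \in I -> n i = 0%N) ->
  exists2 m : L, rng m = v & kdeg m = n.
Proof.
have [j] := ubnP (\sum_i n i); elim: j => // j IH in v n *.
move=> jn st nI; have [[i ni]|n0] := pselect (exists i, (0 < n i)%N).
  have /stuck_setP/contrapT[e [ev de]] : i \notin stuck_set v.
    rewrite (stable_stuck_set st); apply/negP => /nI ni0.
    by rewrite ni0 in ni.
  have ine : dle (dunit i) n.
    by apply/dleP => t; rewrite ffunE; case: eqP => // ->.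
  have nE := dsubKC ine.
  have [||| m me dm] := IH (src e) (dsub n (dunit i)).
  - move: jn; rewrite ltnS; apply: leq_trans; rewrite -[in leqRHS]nE.
    under [leqRHS]eq_bigr do rewrite daddE.
    rewrite big_split /= -add1n leq_add2r (bigD1 i) //= ffunE eqxx.
    exact: leq_addr.
  - by apply: stable_src; rewrite ev.
  - by move=> t tI; rewrite ffunE nI.
  exists (kcomp e m); first by rewrite rng_comp.
  by rewrite deg_comp // de dm.
exists (idp v); first by rewrite rng_idp.
rewrite deg_idp; apply/ffunP => i; rewrite ffunE.
by apply/esym/eqP; rewrite -leqn0 leqNgt; apply/negP => ni; apply: n0; exists i.
Qed.

(** After [l0] reaches a stable vertex, paths of degree [o], one step in each direction outside I,
    are appended forever. The limit has the degree of [l0] in the directions of I and is infinite in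
    the others. *)
Lemma exists_bpath v : exists x : bpath L, brng x = v.
Proof.
have [l0 l0v st0] := exists_stable v.
set I := stuck_set (src l0) in st0.
pose o : deg k := [ffun i => nat_of_bool (i \notin I)].
(* The default is never taken from a stable source, by [stable_path]. *)
pose ext l := kcomp l (xget (idp (src l)) [set m : L | rng m = src l /\ kdeg m = o]).
pose s j := iter j ext l0.
have extP l : stable I (src l) -> exists m,
    [/\ src l = rng m, kdeg m = o & ext l = kcomp l m].
  move=> st; rewrite /ext; case: xgetP => [m _ [ml dm]|none].
    by exists m.
  have [|m ml dm] := stable_path st (_ : forall i, i \in I -> o i = 0%N).
    by move=> i iI; rewrite ffunE iI.
  by case: (none m).
have sP j : [/\ rng (s j) = v, stable I (src (s j))
    & forall i, kdeg (s j) i = (kdeg l0 i + j * (i \notin I))%N].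
  elim: j => [|j [rs ss ds]]; first by split=> // i; rewrite mul0n addn0.
  rewrite /s iterS -/(s j); have [m [sm dm ->]] := extP _ ss.
  split; first by rewrite rng_comp.
    by rewrite src_comp //; apply: stable_src; rewrite -sm.
  move=> i; rewrite deg_comp // daddE dm ds ffunE; lia.
have dles n j : (forall i, i \in I -> n i <= kdeg l0 i)%N ->
    (\sum_i n i <= j)%N -> dle n (kdeg (s j)).
  move=> nI nj; apply/dleP => i; have [_ _ ->] := sP j.
  case: (boolP (i \in I)) => [/nI|iI]; first by lia.
  have : (n i <= \sum_i n i)%N by rewrite (bigD1 i) //= leq_addr.
  by lia.
have ks n j j' : (j <= j')%N -> dle n (kdeg (s j)) ->
    kinit n (s j') = kinit n (s j).
  move=> /subnKC <-; elim: (j' - j)%N => [|d IH] nj; first by rewrite addn0.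
  rewrite addnS /s iterS -/(s (j + d)%N).
  have [_ ss ds] := sP (j + d)%N; have [m [sm dm ->]] := extP _ ss.
  rewrite kinit_comp ?IH //; apply: dle_trans nj _.
  by apply/dleP => i; have [_ _ ->] := sP j; rewrite ds; lia.
pose M : ideg k := [ffun i => if i \in I then Some (kdeg l0 i) else None].
have MI n : dlei n M -> forall i, i \in I -> (n i <= kdeg l0 i)%N.
  by move=> /dleiP nM i iI; apply: (nM i); rewrite ffunE iI.
(* The sum bounds each n_i, so this many steps suffice to reach degree n outside I; by [ks] any
   later stage gives the same prefix. *)
pose P n := kinit n (s (\sum_i n i)%N).
have dP n : dlei n M -> dle n (kdeg (s (\sum_i n i)%N)).
  by move=> /MI nM; exact: dles.
have [|||x dx xP] := @bpath_of_prefixes k L M P.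
- by move=> n /dP /ksplitP[].
- move=> p q pq qM; have pM := dle_dlei pq qM.
  rewrite /P kinitK ?dP //; apply: ks; last exact: dP.
  by apply: leq_sum => i _; move/dleP: pq.
(* Above the degree of [l0], the prefix [P n] passes through the stable vertex [src l0], so the
   stuck directions at its source are exactly I, the finite directions of M. *)
- exists (kdeg l0); first by apply/dleiP => i a; rewrite ffunE; case: ifP => // _ [<-].
  move=> n l0n nM i; rewrite ffunE; case: ifP => // iI _.
  apply/stuck_setP; suff -> : stuck_set (src (P n)) = I by [].
  have [d e E] := ksplitP (dP _ nM).
  have l0P : dle (kdeg l0) (kdeg (P n)) by rewrite /P d.
  have [d' e' E'] := ksplitP l0P.
  have l0E : kinit (kdeg l0) (P n) = l0.
    rewrite /P kinitK // ?dP // (@ks _ 0%N) ?dle_refl //.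
    exact: kinit_id.
  rewrite E' src_comp //; apply: st0.
  by rewrite -e' l0E.
exists x; rewrite -(seg0_rng (dlei0 _)) xP ?dlei0 //.
by rewrite rng_kinit ?dP ?dlei0 //; have [] := sP (\sum_i (0%R : deg k) i)%N.
Qed.

End Existence.

(** * Operators on l2 *)

Section L2Lemmas.
Variables (R : realType) (X : choiceType).
Local Notation H := (l2 R X).
Implicit Types (f g : H) (S T U : bop R X).

Lemma sqmod0 : sqmod (0 : R[i]) = 0.
Proof. by rewrite /sqmod /= expr0n /= addr0. Qed.

Lemma sqmod_eq0 (z : R[i]) : sqmod z = 0 -> z = 0.
Proof.
case: z => a b; rewrite /sqmod /= => /eqP.
rewrite paddr_eq0 ?sqr_ge0 // !sqrf_eq0 => /andP[/eqP-> /eqP->].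
by [].
Qed.

Lemma esum_ge_term (u : X -> \bar R) (D : set X) x : D x ->
  (forall y, 0 <= u y)%E -> (u x <= \esum_(y in D) u y)%E.
Proof.
move=> Dx u0; apply: ereal_sup_ubound; exists [set x].
  by split; [exact: finite_set1 | move=> y ->].
by rewrite fsbig_set1.
Qed.

Lemma l2norm_eq0 f : l2norm f = 0 -> f = 0.
Proof.
move=> f0; apply: l2_ext => x; apply: sqmod_eq0; apply/eqP.
rewrite eq_le sqmod_ge0 andbT -lee_fin.
have : sqsum f = 0%E by rewrite -sqr_l2norm f0 expr0n.
have := @esum_ge_term (fun x => (sqmod (f x))%:E) setT x I.
rewrite -/(sqsum f) => + sf0; rewrite sf0; apply => y.
by rewrite lee_fin sqmod_ge0.
Qed.

Lemma esum_support1 (u : X -> \bar R) x : (0 <= u x)%E ->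
  (forall y, y <> x -> u y = 0%E) -> \esum_(y in [set: X]) u y = u x.
Proof.
move=> ux0 u0; rewrite -(esum_set1 ux0) [RHS]esum_mkcond.
apply: eq_esum => y _; case: ifPn => // /negP yx.
by apply: u0 => e; apply: yx; rewrite e inE.
Qed.

Lemma rsum_support1 (u : X -> R) x : (forall y, y <> x -> u y = 0) ->
  rsum u = u x.
Proof.
move=> u0; rewrite /rsum (@esum_support1 _ x) ?(@esum_support1 _ x) //.
- rewrite funeposE funenegE /= -!EFin_max /=.
  by case: (leP (u x) 0) => ux; case: (leP (- u x) 0) => ux' /=; lra.
- by move=> y yx; rewrite funenegE /= u0 // oppr0 maxxx.
- by move=> y yx; rewrite funeposE /= u0 // maxxx.
Qed.

Lemma csum_support1 (u : X -> R[i]) x : (forall y, y <> x -> u y = 0) ->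
  csum u = u x.
Proof.
move=> u0; rewrite /csum !(@rsum_support1 _ x) => [|y /u0 -> //|y /u0 -> //].
by case: (u x).
Qed.

(** Reads off coordinates, which is what makes adjoints unique; the conjugate appears because
    [inner] is conjugate-linear in its second argument. *)
Lemma inner_basis x f : inner (l2_basis R x) f = conjc (f x).
Proof.
rewrite /inner (@csum_support1 _ x) /= ?eqxx ?mul1r // => y /eqP /negbTE ->.
by rewrite mul0r.
Qed.

Lemma is_adjoint_uniq T U U' : is_adjoint T U -> is_adjoint T U' -> U = U'.
Proof.
move=> TU TU'; apply: bop_ext => g; apply: l2_ext => x.
apply: (can_inj (@conjcK R)).
by rewrite -!inner_basis -TU TU'.
Qed.

Lemma adjoint_eq T U : is_adjoint T U -> adjoint T = U.
Proof.
move=> TU; rewrite /adjoint; case: xgetP => [V _ TV|/(_ U)//].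
exact: is_adjoint_uniq TV TU.
Qed.

Lemma bop_sumE (I : Type) (r : seq I) (F : I -> bop R X) f :
  (\sum_(i <- r) F i) f = \sum_(i <- r) F i f.
Proof. by elim/big_rec2: _ => // i a b _ <-. Qed.

Lemma l2_sumE (I : Type) (r : seq I) (F : I -> H) x :
  (\sum_(i <- r) F i) x = \sum_(i <- r) F i x.
Proof. by elim/big_rec2: _ => // i a b _ <-. Qed.

Lemma bop0 T : T 0 = 0.
Proof. by apply: (@addrI _ (T 0)); rewrite -bopD !addr0. Qed.

Lemma bopZ T a f : T (a *: f) = a *: T f.
Proof.
by have [lin _] := bopP T; have := lin a f 0; rewrite bop0 !addr0.
Qed.

Lemma bop_sum T (I : Type) (r : seq I) (F : I -> H) :
  T (\sum_(i <- r) F i) = \sum_(i <- r) T (F i).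
Proof. by elim/big_rec2: _ => [|i a b _ <-]; [exact: bop0 | exact: bopD]. Qed.

(** Choose a finite set A whose partial sum of squares is within e of the supremum; the remainder is
    supported off A, and its square norm is the sum over the complement. *)
Lemma l2_approx f (e : R) : 0 < e -> exists r : seq X,
  l2norm (f - \sum_(x <- r) f x *: l2_basis R x) ^+ 2 <= e.
Proof.
move=> e0; have sq0 x : (0 <= (sqmod (f x))%:E)%E by rewrite lee_fin sqmod_ge0.
have ffin : sqsum f \is a fin_num by rewrite ge0_fin_numE ?sqsum_ge0 ?l2P.
have [_ [A [finA _] <-] lA] := ub_ereal_sup_adherent e0 ffin.
have [r0 Ar0] := (finite_seqP A).1 finA.
have Ar x : (x \in A) = (x \in undup r0).
  by rewrite mem_undup Ar0; apply/asboolP/idP.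
exists (undup r0); rewrite -lee_fin sqr_l2norm.
set g := f - _.
have gE x : g x = if x \in A then 0 else f x.
  have -> : g x = f x - (\sum_(y <- undup r0) f y *: l2_basis R y) x by [].
  have -> : (\sum_(y <- undup r0) f y *: l2_basis R y) x =
      if x \in A then f x else 0.
    rewrite l2_sumE (eq_bigr (fun y => f y * (x == y)%:R)); last by [].
    case: ifPn => xA.
      rewrite (bigD1_seq x) ?undup_uniq -?Ar //=.
      rewrite eqxx mulr1 big1 ?addr0 // => y /negbTE yx.
      by rewrite eq_sym yx mulr0.
    rewrite big_seq big1 // => y; rewrite -Ar => yA /=.
    rewrite (_ : x == y = false) ?mulr0 //; apply/eqP => xy.
    by move: xA; rewrite xy yA.
  by case: ifP; rewrite ?subrr ?subr0.
have -> : sqsum g = \esum_(x in ~` A) (sqmod (f x))%:E.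
  rewrite [RHS]esum_mkcond; apply: eq_esum => x _; rewrite gE in_setC.
  by case: ifP => //= _; rewrite sqmod0.
have := @esumID R X A setT _ (fun x _ => sq0 x).
rewrite !setTI (esum_fset finA) // => E.
have {}lA : (sqsum f - e%:E < \sum_(i \in A) (sqmod (f i))%:E)%E := lA.
move: lA ffin; rewrite /sqsum E => lA ffin.
have : (\sum_(i \in A) (sqmod (f i))%:E)%E \is a fin_num.
  by move: ffin; rewrite fin_numD => /andP[].
have : (\esum_(x in ~` A) (sqmod (f x))%:E)%E \is a fin_num.
  by move: ffin; rewrite fin_numD => /andP[].
move: lA; case: (\esum_(x in ~` A) _)%E => // b; case: (\sum_(i \in A) _)%E => // a.
by rewrite -EFinD !lte_fin lee_fin => + _ _; lra.
Qed.

(** The difference D is bounded and kills finite combinations of basis vectors, so D f equals D of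
    an arbitrarily small remainder. *)
Lemma bop_basis_ext S T : (forall x, S (l2_basis R x) = T (l2_basis R x)) ->
  S = T.
Proof.
move=> ST; apply/eqP; rewrite -subr_eq0; apply/eqP; apply: bop_ext => f.
have D0 x : (S - T) (l2_basis R x) = 0.
  by rewrite -[LHS]/(S (l2_basis R x) - T (l2_basis R x)) ST subrr.
move: (S - T) D0 => {S T ST} D D0.
apply: l2norm_eq0; apply/eqP; rewrite -sqrf_eq0 eq_le sqr_ge0 andbT.
have [_ [c Dc]] := bopP D.
apply/ler_addgt0Pl => e e0; rewrite addr0.
(* The remainder is taken with square norm at most e / (c^2 + 1), so that multiplying by c^2 stays
   below e, also when c = 0. *)
have c1 : 0 < c ^+ 2 + 1 by rewrite ltr_wpDl ?sqr_ge0.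
have [r fr] := l2_approx f (divr_gt0 e0 c1).
set g := f - _ in fr.
have -> : D f = D g.
  rewrite /g bopD -scaleN1r bopZ bop_sum big1 ?scaler0 ?addr0 // => x _.
  by rewrite bopZ D0 scaler0.
have Dg : l2norm (D g) ^+ 2 <= c ^+ 2 * l2norm g ^+ 2.
  rewrite -exprMn ler_sqr ?nnegrE ?l2norm_ge0 //.
  exact: le_trans (l2norm_ge0 _) (Dc g).
apply: le_trans Dg _; apply: le_trans (ler_wpM2l (sqr_ge0 c) fr) _.
rewrite mulrCA ler_piMr ?(ltW e0) // ler_pdivrMr // mul1r.
by rewrite lerDl.
Qed.

End L2Lemmas.

(** * Operators induced by partial bijections of the basis *)

Section PartialBijections.
Variables (R : realType) (X : choiceType).
Local Notation H := (l2 R X).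

(** A relation in which [r y x] means that x is sent to y. Inversion is then a swap of arguments,
    and domain and range need no separate description. *)
Record pbij := PBij {
  pbrel :> X -> X -> Prop;
  pbrel_fun : forall y y' x, pbrel y x -> pbrel y' x -> y = y';
  pbrel_inj : forall y x x', pbrel y x -> pbrel y x' -> x = x'
}.
Implicit Types (r : pbij) (f g : H).

Definition pbinv r : pbij :=
  @PBij (fun x y => r y x) (fun x x' y => @pbrel_inj r y x x')
    (fun x y y' => @pbrel_fun r y y' x).

Definition pbval r (f : X -> R[i]) (y : X) : R[i] :=
  if pselect (exists x, r y x) is left h then f (sval (cid h)) else 0.

Lemma pbvalE r f y x : r y x -> pbval r f y = f x.
Proof.
move=> ryx; rewrite /pbval; case: pselect => [h|[]]; last by exists x.
by case: cid => x' /= ryx'; congr (f _); exact: pbrel_inj ryx' ryx.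
Qed.

Lemma pbvalN r f y : ~ (exists x, r y x) -> pbval r f y = 0.
Proof. by rewrite /pbval; case: pselect. Qed.

(** Outside the range and the domain the terms vanish, and between these two sets [r] is a genuine
    bijection, along which the sum is reindexed. *)
Lemma esum_pbij r (u v : X -> \bar R) :
  (forall y x, r y x -> u y = v x) ->
  (forall y, ~ (exists x, r y x) -> u y = 0%E) ->
  (forall x, ~ (exists y, r y x) -> v x = 0%E) ->
  \esum_(y in [set: X]) u y = \esum_(x in [set: X]) v x.
Proof.
move=> uv u0 v0.
have -> : \esum_(y in [set: X]) u y = \esum_(y in [set y | exists x, r y x]) u y.
  rewrite [RHS]esum_mkcond; apply: eq_esum => y _; case: ifPn => //.
  by move=> /negP ny; apply: u0 => h; apply: ny; rewrite inE.
have -> : \esum_(x in [set: X]) v x = \esum_(x in [set x | exists y, r y x]) v x.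
  rewrite [RHS]esum_mkcond; apply: eq_esum => x _; case: ifPn => //.
  by move=> /negP ny; apply: v0 => h; apply: ny; rewrite inE.
pose e (x : X) := xget x [set y | r y x].
have eP x : (exists y, r y x) -> r (e x) x.
  by move=> [y ryx]; rewrite /e; case: xgetP => [z _ //|/(_ y)//].
rewrite (@reindex_esum _ _ _ [set x | exists y, r y x] _ e).
  by apply: eq_esum => x /eP /uv.
split.
- by move=> x /eP ex; exists x.
- move=> x x'; rewrite !inE => /eP a /eP b E; rewrite E in a.
  exact: pbrel_inj a b.
- move=> y [x ryx]; exists x; first by exists y.
  by apply: (pbrel_fun (eP _ _) ryx); exists y.
Qed.

Lemma sqsum_pbval_le r f : (sqsum (pbval r f) <= sqsum f)%E.
Proof.
(* The restriction of [f] to the domain of [r] has the same square sum as the transported function,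
   and at most that of [f]. *)
pose f' x : R[i] := if `[< exists y, r y x >] then f x else 0.
rewrite (_ : sqsum (pbval r f) = sqsum f').
  apply: le_esum => x _; rewrite lee_fin /f'; case: asboolP => // _.
  by rewrite sqmod0 sqmod_ge0.
apply: (@esum_pbij r).
- move=> y x ryx; rewrite (pbvalE _ ryx) /f'; case: asboolP => // -[].
  by exists y.
- by move=> y ny; rewrite pbvalN // sqmod0.
- by move=> x nx; rewrite /f'; case: asboolP => // _; rewrite sqmod0.
Qed.

Lemma pbval_l2P r f : (sqsum (pbval r f) < +oo)%E.
Proof. exact: le_lt_trans (sqsum_pbval_le r f) (l2P f). Qed.

Definition pbop_fun r f : H := L2 (pbval_l2P r f).

Lemma pbopP r : bounded_linear (pbop_fun r).
Proof.
split=> [a f g|].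
  apply: l2_ext => y.
  rewrite -[LHS]/(pbval r (a *: f + g) y) -[RHS]/(a * pbval r f y + pbval r g y).
  have [[x ryx]|n] := pselect (exists x, r y x); first by rewrite !(pbvalE _ ryx).
  by rewrite !pbvalN // mulr0 addr0.
exists 1 => f; rewrite mul1r /l2norm ler_wsqrtr // fine_le //.
- by rewrite ge0_fin_numE ?sqsum_ge0 ?l2P.
- by rewrite ge0_fin_numE ?sqsum_ge0 ?l2P.
- exact: sqsum_pbval_le.
Qed.

Definition pbop r : bop R X := Bop (pbopP r).

Lemma pbopE r f y x : r y x -> pbop r f y = f x.
Proof. exact: pbvalE. Qed.

Lemma pbopN r f y : ~ (exists x, r y x) -> pbop r f y = 0.
Proof. exact: pbvalN. Qed.

Lemma pbop_basis r y x : r y x -> pbop r (l2_basis R x) = l2_basis R y.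
Proof.
move=> ryx; apply: l2_ext => z.
have [[w rzw]|n] := pselect (exists x, r z x).
  rewrite (pbopE _ rzw) /=; congr (_%:R); congr nat_of_bool.
  apply/eqP/eqP => E; first by apply: pbrel_fun rzw _; rewrite E.
  by rewrite E in rzw; exact: pbrel_inj rzw ryx.
rewrite pbopN //=; case: eqP => // E; case: n; exists x; by rewrite E.
Qed.

Lemma pbop_basis0 r x : ~ (exists y, r y x) -> pbop r (l2_basis R x) = 0.
Proof.
move=> nx; apply: l2_ext => z.
have [[w rzw]|n] := pselect (exists x, r z x); last by rewrite pbopN.
rewrite (pbopE _ rzw) /=; case: eqP => // E; case: nx; exists z.
by rewrite -E.
Qed.

Lemma rsum_pbij r (u v : X -> R) :
  (forall y x, r y x -> u y = v x) ->
  (forall y, ~ (exists x, r y x) -> u y = 0) ->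
  (forall x, ~ (exists y, r y x) -> v x = 0) ->
  rsum u = rsum v.
Proof.
move=> uv u0 v0; rewrite /rsum; congr (fine _ - fine _).
  apply: (@esum_pbij r).
  - by move=> y x /uv e; rewrite !funeposE /= e.
  - by move=> y /u0 e; rewrite funeposE /= e maxxx.
  - by move=> x /v0 e; rewrite funeposE /= e maxxx.
apply: (@esum_pbij r).
- by move=> y x /uv e; rewrite !funenegE /= e.
- by move=> y /u0 e; rewrite funenegE /= e oppr0 maxxx.
- by move=> x /v0 e; rewrite funenegE /= e oppr0 maxxx.
Qed.

(** Both inner products sum f(x) times the conjugate of g(y) over the pairs related by [r]. *)
Lemma pbop_adjoint r : adjoint (pbop r) = pbop (pbinv r).
Proof.
apply: adjoint_eq => f g; rewrite /inner /csum.
have uv y x : r y x ->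
    pbop r f y * conjc (g y) = f x * conjc (pbop (pbinv r) g x).
  by move=> ryx; rewrite (pbopE _ ryx) (@pbopE (pbinv r) g x y).
have u0 y : ~ (exists x, r y x) -> pbop r f y * conjc (g y) = 0.
  by move=> /pbopN ->; rewrite mul0r.
have v0 x : ~ (exists y, r y x) -> f x * conjc (pbop (pbinv r) g x) = 0.
  by move=> /(@pbopN (pbinv r)) ->; rewrite conjc0 mulr0.
congr Complex; apply: (@rsum_pbij r).
- by move=> y x /uv ->.
- by move=> y /u0 ->.
- by move=> x /v0 ->.
- by move=> y x /uv ->.
- by move=> y /u0 ->.
- by move=> x /v0 ->.
Qed.

End PartialBijections.

(** * The operators of a k-graph *)

Section PathOperators.
Variables (R : realType) (k : nat) (L : kgraph k).
Local Notation B := (bop R (bpath L)).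
Implicit Types (x y z w : bpath L) (l m : L) (f : l2 R (bpath L)).

Definition concat_pbij l : pbij (bpath L) :=
  @PBij _ (fun y x => is_concat l x y) (fun y y' x => @is_concat_fun _ _ l x y y')
    (fun y x x' => @is_concat_inj _ _ l x x' y).

Definition pathop l : B := pbop R (concat_pbij l).
Definition copathop l : B := pbop R (pbinv (concat_pbij l)).

Lemma concatP l x : src l = brng x -> is_concat l x (concat l x).
Proof.
move=> /is_concat_exists[y cy].
by rewrite /concat; case: xgetP => [z _ //|/(_ y)].
Qed.

Lemma path_operators_pathop : path_operators pathop.
Proof.
move=> l x; case: eqP => [/concatP c|n].
  exact: (@pbop_basis _ _ (concat_pbij l)).
by apply: pbop_basis0 => -[y /is_concat_src].
Qed.

Lemma path_operators_uniq (S : L -> B) : path_operators S -> S = pathop.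
Proof.
move=> PS; apply/funext => l; apply: bop_basis_ext => x.
by rewrite PS path_operators_pathop.
Qed.

Lemma adjoint_pathop l : adjoint (pathop l) = copathop l.
Proof. exact: pbop_adjoint. Qed.

Lemma pathopE l f x y : is_concat l x y -> pathop l f y = f x.
Proof. exact: (@pbopE _ _ (concat_pbij l)). Qed.

Lemma pathopN l f y : ~ (exists x, is_concat l x y) -> pathop l f y = 0.
Proof. exact: (@pbopN _ _ (concat_pbij l)). Qed.

Lemma copathopE l f x y : is_concat l x y -> copathop l f x = f y.
Proof. exact: (@pbopE _ _ (pbinv (concat_pbij l))). Qed.

Lemma copathopN l f x : ~ (exists y, is_concat l x y) -> copathop l f x = 0.
Proof. exact: (@pbopN _ _ (pbinv (concat_pbij l))). Qed.

Lemma pathop_idpE v f x :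
  pathop (idp v) f x = if `[< brng x = v >] then f x else 0.
Proof.
case: asboolP => [xv|n]; first by apply: pathopE; apply/is_concat_idp.
by apply: pathopN => -[y /is_concat_idp[-> //]].
Qed.

(** The range projection of S_l is multiplication by the indicator of the paths that start with
    l. *)
Lemma pathop_rangeE l f y : pathop l (copathop l f) y =
  if `[< exists x, is_concat l x y >] then f y else 0.
Proof.
case: asboolP => [[x c]|n]; last by rewrite pathopN.
by rewrite (pathopE _ c) (copathopE _ c).
Qed.

Lemma pathop_comp l m : src l = rng m -> pathop l * pathop m = pathop (kcomp l m).
Proof.
move=> lm; apply: bop_ext => f; apply: l2_ext => z.
rewrite -[LHS]/(pathop l (pathop m f) z).
have [[x c]|n] := pselect (exists x, is_concat (kcomp l m) x z).
  have [y cm cl] := is_concat_comp lm c.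
  by rewrite (pathopE _ c) (pathopE _ cl) (pathopE _ cm).
rewrite [RHS]pathopN //.
have [[y cl]|nl] := pselect (exists y, is_concat l y z); last by rewrite pathopN.
rewrite (pathopE _ cl) pathopN // => -[x cm].
by apply: n; exists x; exact: is_concat_trans cm cl.
Qed.

(** Evaluated at x, both sides are f(y) if l x = m y for some y, and 0 otherwise. *)
Lemma copathop_pathop l m : finite_set (min_ext l m) ->
  copathop l * pathop m =
  \sum_(ab \in min_ext l m) (pathop ab.1 * copathop ab.2).
Proof.
move=> fin; apply: bop_ext => f; apply: l2_ext => x.
rewrite -[LHS]/(copathop l (pathop m f) x) fsbig_finite // bop_sumE l2_sumE.
rewrite (eq_bigr (fun ab => pathop ab.1 (copathop ab.2 f) x)) // -fsbig_finite //.
have term0 ab : min_ext l m ab -> pathop ab.1 (copathop ab.2 f) x <> 0 ->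
    exists w, is_concat ab.1 w x /\ exists y, is_concat ab.2 w y.
  move=> _ nz; have [[w c]|n] := pselect (exists w, is_concat ab.1 w x); last first.
    by case: nz; rewrite pathopN.
  exists w; split=> //; apply: contrapT => n; apply: nz.
  by rewrite (pathopE _ c) copathopN.
have [[y [z cl cm]]|none] := pselect (exists y, exists2 z, is_concat l x z & is_concat m y z).
  have [ab0 [w [m0 ca cb]]] := is_concat_min_ext cl cm.
  rewrite (copathopE _ cl) (pathopE _ cm).
  (* Only [ab0] contributes: the first component of a nonzero term is the initial segment of x of a
     fixed degree, and the second then follows by cancelling [m]. *)
  rewrite -(fsbig_widen [set ab0]) ?fsbig_set1.
  - by rewrite (pathopE _ ca) (copathopE _ cb).
  - by move=> ab ->.
  move=> ab [mab /eqP nab]; apply: contrapT => nz.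
  have [w' [ca' [y' cb']]] := term0 _ mab nz.
  case/negP: nab; apply/eqP.
  have e1 : ab.1 = ab0.1.
    by apply: is_concat_deg_inj ca' ca _; rewrite (min_ext_deg mab) (min_ext_deg m0).
  case: mab m0 => la mb E _ [la0 mb0 E0 _].
  have [_ e2] : m = m /\ ab.2 = ab0.2.
    by apply: kcomp_inj => //; rewrite -E -E0 e1.
  by rewrite [LHS]surjective_pairing e1 e2 -surjective_pairing.
rewrite fsbig1 => [|ab mab]; last first.
  apply: contrapT => nz; have [w [ca [y cb]]] := term0 _ mab nz.
  have [z cl cm] := min_ext_concat mab ca cb.
  by apply: none; exists y, z.
have [[z cl]|n] := pselect (exists z, is_concat l x z); last by rewrite copathopN.
rewrite (copathopE _ cl) pathopN // => -[y cm].
by apply: none; exists y, z.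
Qed.

(** Each factor multiplies the value at x by a scalar [c l], so it is enough that one of these
    scalars vanishes at each x. *)
Lemma prod_gap_eq0 v (E : seq L) : exhaustive v [set` E] ->
  \prod_(l <- E) (pathop (idp v) - pathop l * copathop l) = 0.
Proof.
move=> exhE; apply: bop_ext => f; apply: l2_ext => x; rewrite -[RHS]/(0 : R[i]).
pose c l : R[i] := (`[< brng x = v >])%:R - (`[< exists y, is_concat l y x >])%:R.
have gapE l g : (pathop (idp v) - pathop l * copathop l) g x = c l * g x.
  rewrite -[LHS]/(pathop (idp v) g x - pathop l (copathop l g) x).
  rewrite pathop_idpE pathop_rangeE /c mulrBl.
  by case: asboolP => _; case: asboolP => _; rewrite ?mul1r ?mul0r.
have -> : (\prod_(l <- E) (pathop (idp v) - pathop l * copathop l)) f x =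
    \prod_(l <- E) c l * f x.
  elim: E {exhE} => [|l E IH]; first by rewrite !big_nil mul1r.
  rewrite !big_cons -mulrA -IH -gapE.
  by [].
suff [l lE cl] : exists2 l, l \in E & c l = 0.
  by rewrite (big_rem l) //= cl !mul0r.
have [xv|nxv] := pselect (brng x = v).
  have [l lE ly] := exhaustive_concat exhE xv; exists l => //.
  by rewrite /c asboolT // asboolT // subrr.
(* Exhaustiveness at the vertex itself shows that E is nonempty. Any element serves, since x, with
   range other than v, starts with no path of range v. *)
have [Ev exh] := exhE; have [l lE _] := exh (idp v) (rng_idp v).
exists l => //; rewrite /c asboolF // asboolF ?subrr // => -[y ly].
by apply: nxv; rewrite (is_concat_rng ly); exact: Ev.
Qed.

Lemma cuntz_krieger_pathop : finitely_aligned L ->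
  cuntz_krieger (@adjoint R (bpath L)) pathop.
Proof.
move=> finL; have adjE := adjoint_pathop.
have coidp v : copathop (idp v) = pathop (idp v).
  apply: bop_ext => f; apply: l2_ext => x; rewrite pathop_idpE.
  case: asboolP => [xv|n]; first by apply: copathopE; apply/is_concat_idp.
  by apply: copathopN => -[y /is_concat_idp[_]].
split=> [l|v|v w vw|l m|l m|v E _ exhE].
(* S_l f is supported on paths starting with l, where the range projection is the identity. *)
- rewrite adjE -mulrA; apply: bop_ext => f; apply: l2_ext => y.
  rewrite -[LHS]/(pathop l (copathop l (pathop l f)) y) pathop_rangeE.
  by case: asboolP => // n; rewrite pathopN.
- split; last by rewrite adjE coidp.
  apply: bop_ext => f; apply: l2_ext => x.
  rewrite -[LHS]/(pathop (idp v) (pathop (idp v) f) x) !pathop_idpE.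
  by case: asboolP.
- apply: bop_ext => f; apply: l2_ext => x.
  rewrite -[LHS]/(pathop (idp v) (pathop (idp w) f) x) !pathop_idpE.
  by case: asboolP => // ->; case: asboolP.
- exact: pathop_comp.
- rewrite adjE copathop_pathop //.
  by apply: eq_fsbigr => ab _; rewrite adjE.
- rewrite -[RHS](prod_gap_eq0 exhE).
  by apply: eq_bigr => l _; rewrite adjE.
Qed.

(** A boundary path x with range v gives a basis vector fixed by S_v, seen in its coordinate 1 at
    x. *)
Lemma pathop_idp_neq0 v : pathop (idp v) <> 0.
Proof.
have [x xv] := exists_bpath v.
move=> /(congr1 (fun T : B => T (l2_basis R x) x)).
rewrite pathop_idpE asboolT //= eqxx => /eqP.
by rewrite oner_eq0.
Qed.

End PathOperators.

Theorem proposition2p12 (R : realType) (k : nat) (L : kgraph k)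
    (hL : finitely_aligned L) :
  (exists! S : L -> bop R (bpath L), path_operators S) /\
  (forall S : L -> bop R (bpath L), path_operators S ->
     cuntz_krieger (@adjoint R (bpath L)) S /\
     forall v : vertex L, S (idp v) <> 0).
Proof.
split.
  exists (@pathop R k L); split; first exact: path_operators_pathop.
  by move=> S /path_operators_uniq.
move=> S /path_operators_uniq ->; split; first exact: cuntz_krieger_pathop.
exact: pathop_idp_neq0.
Qed.
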